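(* Let $K\le0$, $N\in[3,\infty)$, and let $(X,\mathsf d,\mathfrak m)$ be a non-compact $\mathsf{RCD}(K,N)$ space. Then the essential spectrum of $-\Delta$ intersects the interval $\big[0,-\tfrac{(N-1)K}{4}\big]$.
   Context: **Metric measure spaces.** A metric measure space $(X,\mathsf d,\mathfrak m)$ is a complete separable metric space with a non-negative Borel measure $\mathfrak m$, finite on bounded sets, with $\mathrm{supp}(\mathfrak m)=X$. $\mathrm{Geo}(X)$ is the set of $\gamma\in C([0,1],X)$ with $\mathsf d(\gamma(s),\gamma(t))=|t-s|\,\mathsf d(\gamma(0),\gamma(1))$ for all $s,t$; $e_t(\gamma)=\gamma(t)$. $\mathcal P_2(X)$ is the set of Borel probability measures with finite second moment, with the $2$-Wasserstein distance $W_2$. **Sobolev space.** For a Lipschitz $f$ with bounded support, $\mathrm{lip}(f)(x)=\limsup_{y\to x}\frac{|f(y)-f(x)|}{\mathsf d(y,x)}$ ($0$ at isolated points). The Cheeger energy of $f\in L^2(X,\mathfrak m)$ is $\mathsf{Ch}(f)=\inf\{\liminf_n\frac12\int_X\mathrm{lip}(f_n)^2d\mathfrak m\}$ over sequences of Lipschitz functions $f_n$ with bounded support with $f_n\to f$ in $L^2$. $W^{1,2}(X,\mathsf d,\mathfrak m)=\{\mathsf{Ch}<\infty\}$ with norm $\|f\|^2=\|f\|_{L^2}^2+2\mathsf{Ch}(f)$; $|Df|$ is the minimal weak upper gradient, so $\mathsf{Ch}(f)=\frac12\int_X|Df|^2d\mathfrak m$. **$\mathsf{RCD}(K,N)$.**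 For $\kappa\in\mathbb R$, $\theta\ge0$ let $\mathfrak s_\kappa(\theta)=\frac{1}{\sqrt\kappa}\sin(\sqrt\kappa\theta)$ if $\kappa>0$, $\theta$ if $\kappa=0$, $\frac{1}{\sqrt{-\kappa}}\sinh(\sqrt{-\kappa}\theta)$ if $\kappa<0$. For $t\in[0,1]$ let $\sigma_\kappa^{(t)}(0)=t$, $\sigma_\kappa^{(t)}(\theta)=\mathfrak s_\kappa(t\theta)/\mathfrak s_\kappa(\theta)$ for $\theta>0$ (with $\theta<\pi/\sqrt\kappa$ if $\kappa>0$, and value $+\infty$ for larger $\theta$); $\sigma_{K,N}^{(t)}=\sigma_{K/N}^{(t)}$; and $\tau_{K,N}^{(t)}(\theta)=t^{1/N}\sigma_{K,N-1}^{(t)}(\theta)^{(N-1)/N}$ (with value $+\infty$ for $t>0$, $K>0$, $\theta\ge\pi\sqrt{(N-1)/K}$, and $\tau^{(0)}_{K,N}=0$). $(X,\mathsf d,\mathfrak m)$ is $\mathsf{CD}(K,N)$ if for any $\mu_0=\rho_0\mathfrak m,\ \mu_1=\rho_1\mathfrak m\in\mathcal P_2(X)$ there is $\eta\in\mathcal P(\mathrm{Geo}(X))$ such that $\mu_t=(e_t)_\sharp\eta=\rho_t\mathfrak m$ is a $W_2$-geodesic from $\mu_0$ to $\mu_1$, $\pi=(e_0,e_1)_\sharp\eta$ is an optimal plan for the cost $\mathsf d^2$, and for all $t\in[0,1]$, $N'\ge N$, $$\int_X\rho_t^{1-\frac1{N'}}\,d\mathfrak m\ \ge\ \int_{X\times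 X}\Big[\tau_{K,N'}^{(1-t)}(\mathsf d(x,y))\rho_0(x)^{-\frac1{N'}}+\tau_{K,N'}^{(t)}(\mathsf d(x,y))\rho_1(y)^{-\frac1{N'}}\Big]d\pi(x,y).$$ It is $\mathsf{RCD}(K,N)$ if moreover $W^{1,2}(X,\mathsf d,\mathfrak m)$ is a Hilbert space. **Laplacian.** On an $\mathsf{RCD}(K,N)$ space, $-\Delta:D(\Delta)\subset L^2(X,\mathfrak m)\to L^2(X,\mathfrak m)$ is the subdifferential of the Cheeger energy; it is a non-negative, densely defined, self-adjoint operator with $\int_X-f\,\Delta f\,d\mathfrak m=\int_X|Df|^2d\mathfrak m$ for $f\in D(\Delta)$. Its essential spectrum consists of the cluster points of the spectrum and the eigenvalues of infinite multiplicity. *)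

(* Defs.v *)
From HB Require Import structures.
From mathcomp Require Import all_boot all_order all_algebra.
From mathcomp Require Import all_classical all_reals all_analysis.

Set Implicit Arguments.
Unset Strict Implicit.
Unset Printing Implicit Defensive.
Import Order.TTheory GRing.Theory Num.Theory.
Import numFieldNormedType.Exports.

Local Open Scope classical_set_scope.
Local Open Scope ring_scope.

(* The library's [completeType] is a pointed type, and so is every
   [measurableType]: the space below is thus nonempty, which costs nothing for
   a non-compact space. *)
#[short(type="completeMetricType")]
HB.structure Definition CompleteMetric (R : numDomainType) :=
  {T of Complete T & Metric R T}.

Notation borel T := (g_sigma_algebraType (@open T)).

Section MetricMeasureSpace.
Context {R : realType} {X : completeMetricType R}.

Definition separable_space := exists2 D : set X, countable D & dense D.

Definition metric_bounded (A : set X) := exists x r, A `<=` ball x r.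

Definition msupport (m : {measure set (borel X) -> \bar R}) : set X :=
  [set x | forall U : set X, open_nbhs x U -> (0 < m U)%E].

Definition metric_measure_space (m : {measure set (borel X) -> \bar R}) :=
  [/\ separable_space,
      forall A : set (borel X), measurable A -> metric_bounded A ->
        (m A < +oo)%E
    & msupport m = setT].

End MetricMeasureSpace.

Section Geodesics.
Context {R : realType} {X : completeMetricType R}.

(* The equation makes a geodesic Lipschitz, hence continuous, and the uniform
   structure of [arrow_uniform_type] is that of the sup distance. *)
Definition geodesic : set (arrow_uniform_type {i01 R} X) :=
  [set g | forall s t : {i01 R},
    mdist (g s) (g t) = `|t%:num - s%:num| * mdist (g 0%:i01) (g 1%:i01)].

Definition Geo : Type := set_type geodesic.

Lemma cst_geodesic : (fun=> point) \in geodesic.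
Proof. by rewrite inE => s t /=; rewrite !mdistxx mulr0. Qed.

HB.instance Definition _ := Topological.on Geo.
HB.instance Definition _ := isPointed.Build Geo (SigSub cst_geodesic).

Definition geo_eval (t : {i01 R}) (g : borel Geo) : borel X := \val (g : Geo) t.

End Geodesics.
Arguments Geo {R} X.

Section OptimalTransport.
Context {R : realType} {X : completeMetricType R}.
Local Open Scope ereal_scope.

Definition measure_eq d (T : measurableType d) (mu nu : set T -> \bar R) :=
  forall A, measurable A -> mu A = nu A.

Definition P2 (mu : probability (borel X) R) :=
  exists x0 : X, \int[mu]_x (mdist x0 (x : X) ^+ 2)%:E < +oo.

Definition coupling (mu nu : probability (borel X) R) :
    set (probability (borel X * borel X)%type R) :=
  [set p | measure_eq (pushforward p fst) mu /\
           measure_eq (pushforward p snd) nu].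

Definition transport_cost (p : probability (borel X * borel X)%type R) :=
  \int[p]_xy (mdist (xy.1 : X) (xy.2 : X) ^+ 2)%:E.

Definition W2 (mu nu : probability (borel X) R) : \bar R :=
  sqrte (ereal_inf [set transport_cost p | p in coupling mu nu]).

Definition optimal_plan mu nu (p : probability (borel X * borel X)%type R) :=
  coupling mu nu p /\
  forall q, coupling mu nu q -> transport_cost p <= transport_cost q.

Definition W2_geodesic (mu0 mu1 : probability (borel X) R)
    (mu : {i01 R} -> probability (borel X) R) :=
  [/\ measure_eq (mu (0%:i01)%R) mu0, measure_eq (mu (1%:i01)%R) mu1
    & forall s t, W2 (mu s) (mu t) =
        `|t%:num - s%:num|%:E * W2 (mu (0%:i01)%R) (mu (1%:i01)%R)].

Definition has_density (m : {measure set (borel X) -> \bar R})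
    (mu : probability (borel X) R) (rho : borel X -> R) :=
  [/\ measurable_fun setT rho, forall x, (0 <= rho x)%R
    & measure_eq mu (fun A => \int[m]_(x in A) (rho x)%:E)].

End OptimalTransport.

Section CurvatureDimension.
Context {R : realType}.

Definition sfun (kappa theta : R) : R :=
  if 0 < kappa then sin (Num.sqrt kappa * theta) / Num.sqrt kappa
  else if kappa == 0 then theta
  else let a := Num.sqrt (- kappa) in
       (expR (a * theta) - expR (- (a * theta))) / 2 / a.

Definition sigma (kappa t theta : R) : \bar R :=
  if theta == 0 then t%:E
  else if (0 < kappa) && (pi / Num.sqrt kappa <= theta) then +oo%E
  else (sfun kappa (t * theta) / sfun kappa theta)%:E.

Definition tau (K N t theta : R) : \bar R :=
  if t == 0 then 0%E
  else ((t `^ N^-1)%:E *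
        poweR (sigma (K / (N - 1)) t theta) ((N - 1) / N))%E.

(* [0 `^ a = 0] for [a != 0], whereas the negative powers of the densities
   below are meant to be infinite where these vanish; this is immaterial, as
   [rho0 x] and [rho1 y] are positive for [p]-almost every [(x, y)]. *)
Definition CD {X : completeMetricType R}
    (m : {measure set (borel X) -> \bar R}) (K N : R) :=
  forall (mu0 mu1 : probability (borel X) R) (rho0 rho1 : borel X -> R),
    P2 mu0 -> P2 mu1 -> has_density m mu0 rho0 -> has_density m mu1 rho1 ->
  exists (eta : probability (borel (Geo X)) R)
         (mu : {i01 R} -> probability (borel X) R)
         (rho : {i01 R} -> borel X -> R)
         (p : probability (borel X * borel X)%type R),
  [/\ forall t, measure_eq (mu t) (pushforward eta (geo_eval t)) /\
        has_density m (mu t) (rho t),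
      W2_geodesic mu0 mu1 mu,
      measure_eq p (pushforward eta
        (fun g => (geo_eval 0%:i01 g, geo_eval 1%:i01 g))),
      optimal_plan mu0 mu1 p
    & forall (t : {i01 R}) (N' : R), N <= N' ->
      (\int[p]_xy
         (tau K N' (1 - t%:num)%R (mdist (xy.1 : X) (xy.2 : X)) *
            (rho0 xy.1 `^ (- N'^-1))%:E +
          tau K N' t%:num (mdist (xy.1 : X) (xy.2 : X)) *
            (rho1 xy.2 `^ (- N'^-1))%:E) <=
       \int[m]_x (rho t x `^ (1 - N'^-1))%:E)%E].

End CurvatureDimension.

(* Elements of L^2(X, m) are square-integrable functions; every notion below
   is invariant under equality almost everywhere. *)
Section SobolevSpace.
Context {R : realType} {X : completeMetricType R}.
Variable m : {measure set (borel X) -> \bar R}.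
Local Open Scope ereal_scope.
Implicit Types f g h : borel X -> R.

Definition L2 : set (borel X -> R) := [set f | f \in Lfun m 2%:E].

Definition L2norm f : \bar R := 'N[m]_2%:E[EFin \o f].

Definition L2inner f g : R := (\int[m]_x (f x * g x))%R.

Definition slope f (x : X) : \bar R :=
  if `[< isolated [set: X] x >] then 0
  else limf_esup (fun y : X => (`|f y - f x| / mdist y x)%:E) x^'.

Definition lipschitz_bs f :=
  (exists L : R, forall x y : X, (`|f x - f y| <= L * mdist x y)%R) /\
  metric_bounded (closure [set x : X | f x != 0%R]).

Definition Ch f : \bar R :=
  ereal_inf [set limn_einf (fun n => 2^-1%:E * \int[m]_x slope (u n) x ^+ 2)
            | u in [set u : nat -> borel X -> R |
                     (forall n, lipschitz_bs (u n)) /\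
                     L2norm (u n \- f)%R @[n --> \oo] --> 0]].

Definition W12 : set (borel X -> R) := [set f | L2 f /\ Ch f < +oo].

Definition W12norm f : \bar R := sqrte (L2norm f ^+ 2 + 2%:E * Ch f).

Definition W12_inner_product (ip : (borel X -> R) -> (borel X -> R) -> R) :=
  [/\ forall f g, W12 f -> W12 g -> ip f g = ip g f,
      forall (a : R) f g h, W12 f -> W12 g -> W12 h ->
        ip (fun x => a * f x + g x)%R h = (a * ip f h + ip g h)%R
    & forall f, W12 f -> W12norm f ^+ 2 = (ip f f)%:E].

Definition W12_complete :=
  forall u : nat -> borel X -> R, (forall n, W12 (u n)) ->
    (forall e : R, (0 < e)%R -> exists M, forall i j, (M <= i)%N -> (M <= j)%N ->
      W12norm (u i \- u j)%R < e%:E) ->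
  exists2 f, W12 f & W12norm (u n \- f)%R @[n --> \oo] --> 0.

Definition W12_hilbert := (exists ip, W12_inner_product ip) /\ W12_complete.

(* The graph of the subdifferential of [Ch] in L^2(X, m): [neg_laplacian f g]
   stands for [f] in the domain of the Laplacian and [g = - Delta f]. *)
Definition neg_laplacian f g :=
  [/\ L2 f, L2 g, Ch f < +oo
    & forall h, L2 h -> Ch f + (L2inner g (h \- f)%R)%:E <= Ch h].

End SobolevSpace.

Definition RCD {R : realType} {X : completeMetricType R}
    (m : {measure set (borel X) -> \bar R}) (K N : R) :=
  [/\ metric_measure_space m, CD m K N & W12_hilbert m].

(* A (partial) operator on L^2(X, m) is given by its graph [A f g]. The real
   Hilbert space suffices: the spectrum of a self-adjoint operator is real. *)
Section Spectrum.
Context {R : realType} {X : completeMetricType R}.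
Variable m : {measure set (borel X) -> \bar R}.
Variable A : (borel X -> R) -> (borel X -> R) -> Prop.

Definition shifted (lambda : R) (f g : borel X -> R) :=
  A f (fun x => lambda * f x + g x).

Definition resolvent_set : set R :=
  [set lambda |
    [/\ forall g, L2 m g -> exists f, shifted lambda f g,
        forall g f f', L2 m g -> shifted lambda f g -> shifted lambda f' g ->
          f = f' %[ae m]
      & exists C : R, forall g f, L2 m g -> shifted lambda f g ->
          (L2norm m f <= C%:E * L2norm m g)%E]].

Definition spectrum : set R := ~` resolvent_set.

Definition infinite_multiplicity (lambda : R) :=
  forall n : nat, exists f : 'I_n -> borel X -> R,
    (forall i, A (f i) (fun x => lambda * f i x)) /\
    forall c : 'I_n -> R,
      (fun x => \sum_(i < n) c i * f i x) = cst 0 %[ae m] ->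
      forall i, c i = 0.

Definition essential_spectrum : set R :=
  limit_point spectrum `|` infinite_multiplicity.

End Spectrum.

(* Main.v *)
Require Import Defs.
From HB Require Import structures.
From mathcomp Require Import all_boot all_order all_algebra.
From mathcomp Require Import all_classical all_reals all_analysis.
From mathcomp Require Import measurable_realfun.
From mathcomp Require Import ring lra.
Import Order.TTheory GRing.Theory Num.Theory.
Import numFieldNormedType.Exports.
Local Open Scope classical_set_scope.
Local Open Scope ring_scope.

(** Let [mu = sqrt (- K (N - 1))], so that the interval of the theorem is
    [[0, mu^2 / 4]]. The bound is that of Cheng for the bottom of the spectrum:
    a ball of radius [D] has mass at most [exp (mu D)] times that of the unit
    ball, up to a polynomial factor in [D], while [exp (- b d(x, .))] has
    Rayleigh quotient at most [b^2] and is square-integrable for such a growth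
    as soon as [b > mu / 2].

    Geometry. The growth of balls, uniform in the centre, comes from the
    curvature-dimension inequality applied to the transport of the uniform
    measure of a small ball to that of a large one ([CD_ball_growth]). It forces
    a bounded space to be totally bounded, so that a non-compact one is
    unbounded ([CD_noncompact_unbounded]). It also shows that the exponentials
    with [b] close to [mu / 2], truncated at a large distance [D], have Rayleigh
    quotient at most [mu^2 / 4 + e], with [D] independent of the centre
    ([cone_Rayleigh]). Centred at points far away from each other, they have
    disjoint supports, and all their linear combinations satisfy the same bound;
    some of them satisfy any given finite set of linear constraints
    ([cone_trial_function]).

    Analysis. Since W^{1,2} is a Hilbert space, the Riesz representation provides
    the resolvent [T = (1 - Delta)^-1], a symmetric contraction of W^{1,2} with
    quadratic form the squared norm of L^2. Let [tau] be the largest number that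
    the Rayleigh quotient of [T] approaches on every subspace of finite
    codimension; the trial functions give [tau >= 1 / (1 + mu^2 / 4)]. Either
    [tau] is an accumulation point of the spectrum of [T], or its eigenspace has
    infinite dimension ([essential_spectrum_of_Rayleigh]). The argument is
    elementary: if [tau] is isolated in the spectrum, then [C = T - tau] satisfies
    [|C^2 f| >= r |C f|] for some [r > 0] ([isolated_spectral_gap]), from which
    an iteration turns almost eigenvectors into eigenvectors close to them
    ([almost_kernel_near_kernel]). Finally [lambda = 1 / tau - 1] lies in
    [[0, mu^2 / 4]] and belongs to the essential spectrum of [- Delta], as
    [T - 1 / (1 + l)] is bounded below whenever [l] is in the resolvent set of
    [- Delta] ([resolvent_set_bounded_below]), and the eigenvectors of [T] are
    those of the Laplacian ([eigenvector_neg_laplacian]). *)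

Set Implicit Arguments.
Unset Strict Implicit.
Unset Printing Implicit Defensive.

(** * Semi-inner products and the Riesz representation *)

Section SemiHilbert.
Context {R : realType} {V : lmodType R}.
Implicit Types (b : V -> V -> R) (f g h u v w : V).

Definition symmetric_bilinear b :=
  (forall f g, b f g = b g f) /\
  (forall a f g h, b (a *: f + g) h = a * b f h + b g h).

Section Form.
Context {b : V -> V -> R} (bP : symmetric_bilinear b).

Lemma bilC f g : b f g = b g f. Proof. exact: bP.1. Qed.
Lemma bilPl a f g h : b (a *: f + g) h = a * b f h + b g h.
Proof. exact: bP.2. Qed.
Lemma bil0l h : b 0 h = 0.
Proof. have := bilPl (-1) 0 0 h; rewrite scaler0 addr0 mulN1r addNr; exact. Qed.
Lemma bilDl f g h : b (f + g) h = b f h + b g h.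
Proof. by rewrite -[f]scale1r bilPl mul1r scale1r. Qed.
Lemma bilZl a f h : b (a *: f) h = a * b f h.
Proof. by rewrite -[a *: f]addr0 bilPl bil0l addr0. Qed.
Lemma bilNl f h : b (- f) h = - b f h.
Proof. by rewrite -scaleN1r bilZl mulN1r. Qed.
Lemma bilBl f g h : b (f - g) h = b f h - b g h.
Proof. by rewrite bilDl bilNl. Qed.
Lemma bilDr f g h : b h (f + g) = b h f + b h g.
Proof. by rewrite bilC bilDl !(bilC h). Qed.
Lemma bilZr a f h : b h (a *: f) = a * b h f.
Proof. by rewrite bilC bilZl (bilC h). Qed.
Lemma bilNr f h : b h (- f) = - b h f.
Proof. by rewrite bilC bilNl (bilC h). Qed.
Lemma bilBr f g h : b h (f - g) = b h f - b h g.
Proof. by rewrite bilDr bilNr. Qed.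
Lemma bil_suml n (c : 'I_n -> R) (F : 'I_n -> V) h :
  b (\sum_i c i *: F i) h = \sum_i c i * b (F i) h.
Proof.
elim/big_rec2: _ => [|i x y _ <-]; first exact: bil0l.
by rewrite bilPl.
Qed.

Definition bilE := (bilDl, bilBl, bilZl, bilNl, bilDr, bilBr, bilZr, bilNr).

(** Only the plane spanned by the two vectors matters, so that the inequality
    also applies to forms that are nonnegative on a subspace. *)
Lemma bil_Cauchy_Schwarz f g :
  (forall x y, 0 <= b (x *: f + y *: g) (x *: f + y *: g)) ->
  b f g ^+ 2 <= b f f * b g g.
Proof.
move=> pos.
have q x y : 0 <= x ^+ 2 * b f f + 2 * x * y * b f g + y ^+ 2 * b g g.
  by have := pos x y; rewrite !bilE (bilC g f); congr (0 <= _); ring.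
have f0 := q 1 0; have g0 := q 0 1.
have [g_eq0|g_neq0] := eqVneq (b g g) 0.
  have [->|fg_neq0] := eqVneq (b f g) 0.
    by rewrite expr0n /= mulr_ge0 //; lra.
  have := q 1 (- (b f f + 1) / (2 * b f g)).
  rewrite g_eq0 !mulr0 addr0 expr1n mul1r mulr1.
  have -> : 2 * (- (b f f + 1) / (2 * b f g)) * b f g = - (b f f + 1) by field.
  by lra.
have g_gt0 : 0 < b g g by rewrite lt_def g_neq0 /=; lra.
have := q (b g g) (- b f g).
have -> : b g g ^+ 2 * b f f + 2 * b g g * - b f g * b f g + (- b f g) ^+ 2 * b g g
   = b g g * (b f f * b g g - b f g ^+ 2) by ring.
by rewrite pmulr_rge0 // subr_ge0.
Qed.

End Form.

Context {ip : V -> V -> R} (ipP : symmetric_bilinear ip).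
Hypothesis ip_ge0 : forall f, 0 <= ip f f.

Definition snorm f := Num.sqrt (ip f f).

Let ipE := (@bilE ip ipP).

Lemma ip_CS f g : ip f g ^+ 2 <= ip f f * ip g g.
Proof. exact: bil_Cauchy_Schwarz. Qed.

Lemma ip_null f h : ip f f = 0 -> ip f h = 0.
Proof.
move=> f0; have := ip_CS f h; rewrite f0 mul0r => le0.
by apply/eqP; rewrite -sqrf_eq0 eq_le le0 sqr_ge0.
Qed.

Lemma snorm_ge0 f : 0 <= snorm f. Proof. exact: sqrtr_ge0. Qed.
Lemma sqr_snorm f : snorm f ^+ 2 = ip f f. Proof. exact: sqr_sqrtr. Qed.

Lemma ip_le_snorm f g : ip f g <= snorm f * snorm g.
Proof.
apply: le_trans (ler_norm _) _; rewrite -ler_sqr ?nnegrE ?mulr_ge0 ?snorm_ge0 //.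
by rewrite exprMn !sqr_snorm real_normK ?num_real // ip_CS.
Qed.

Lemma snormD f g : snorm (f + g) <= snorm f + snorm g.
Proof.
rewrite -ler_sqr ?nnegrE ?addr_ge0 ?snorm_ge0 // sqr_snorm sqrrD !sqr_snorm.
rewrite !ipE (bilC ipP g f); have := ip_le_snorm f g; lra.
Qed.

Lemma snormZ a f : snorm (a *: f) = `|a| * snorm f.
Proof. by rewrite /snorm !ipE mulrA -expr2 sqrtrM ?sqr_ge0 // sqrtr_sqr. Qed.

Lemma snormN f : snorm (- f) = snorm f.
Proof. by rewrite -scaleN1r snormZ normrN1 mul1r. Qed.

Lemma snormB f g : snorm (f - g) = snorm (g - f).
Proof. by rewrite -opprB snormN. Qed.

Lemma snorm_triangle f g h : snorm (f - h) <= snorm (f - g) + snorm (g - h).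
Proof. by apply: le_trans (snormD _ _); rewrite subrKA. Qed.

Definition snorm_complete := forall u : nat -> V,
  (forall e, 0 < e -> exists M, forall i j, (M <= i)%N -> (M <= j)%N ->
     snorm (u i - u j) < e) ->
  exists f, forall e, 0 < e -> exists M, forall n, (M <= n)%N ->
     snorm (u n - f) < e.

(** A minimizing sequence of [ip h h - 2 ell h] is Cauchy by the parallelogram
    identity, and the minimizer represents [ell]. *)
Theorem Riesz_representation (ell : V -> R) (C : R) : snorm_complete ->
  (forall a f g, ell (a *: f + g) = a * ell f + ell g) ->
  (forall f, ell f ^+ 2 <= C * ip f f) ->
  exists u, forall h, ip u h = ell h.
Proof.
move=> Vcomp ellP ellC.
have ellZ a f : ell (a *: f) = a * ell f.
  have ell0 : ell 0 = 0 by have := ellP (-1) 0 0; rewrite scaler0 addr0; lra.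
  by have := ellP a f 0; rewrite addr0 ell0 addr0.
pose J h := ip h h - 2 * ell h.
have JD f s h : J (s *: h + f) = J f + 2 * s * (ip f h - ell h) + s ^+ 2 * ip h h.
  by rewrite /J ellP !ipE (bilC ipP h f); ring.
have Jlb f : - `|C| <= J f.
  rewrite lerNl /J opprB.
  have h1 : ell f ^+ 2 <= `|C| * ip f f.
    by apply: le_trans (ellC f) _; rewrite ler_wpM2r // ler_norm.
  have h2 := ip_ge0 f; have h3 := normr_ge0 C.
  rewrite leNgt; apply/negP => h4.
  have h5 : (ip f f + `|C|) ^+ 2 < (2 * ell f) ^+ 2.
    by rewrite ltr_sqr ?nnegrE; lra.
  by have := sqr_ge0 (ip f f - `|C|); lra.
pose S := [set J f | f in [set: V]].
have SJ f : S (J f) by exists f.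
have Sinf : has_inf S.
  by split; [exists (J 0)|exists (- `|C|) => _ [f _ <-]].
pose j := inf S.
have jJ f : j <= J f by apply: ge_inf => //; case: Sinf.
have minim n : exists f, J f < j + n.+1%:R^-1.
  have n0 : 0 < n.+1%:R^-1 :> R by rewrite invr_gt0 ltr0n.
  by have [_ [f _ <-] Hf] := inf_adherent n0 Sinf; exists f.
have [u uP] := choice minim.
have small (e : R) : 0 < e -> exists M, forall n, (M <= n)%N -> n.+1%:R^-1 < e.
  move=> e0; exists (Num.Def.truncn e^-1) => n Mn.
  rewrite invf_plt ?posrE ?ltr0n //; apply: lt_le_trans (truncnS_gt _) _.
  by rewrite ler_nat.
have Cauchy i k : ip (u i - u k) (u i - u k) <= 2 * i.+1%:R^-1 + 2 * k.+1%:R^-1.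
  have := jJ (2^-1 *: u i + 2^-1 *: u k); rewrite /J ellP ellZ !ipE (bilC ipP (u k) (u i)).
  move: (uP i) (uP k); rewrite /J; set a := _^-1; set b := _^-1. lra.
have [|p pP] := Vcomp u.
  move=> e e0; have [|M HM] := small (e ^+ 2 / 4); first by rewrite divr_gt0 // exprn_gt0.
  exists M => i k Mi Mk; rewrite -ltr_sqr ?nnegrE ?snorm_ge0 ?(ltW e0) // sqr_snorm.
  move: (Cauchy i k) (HM i Mi) (HM k Mk).
  by move: (i.+1%:R^-1) (k.+1%:R^-1) => a b; lra.
exists p => h; apply/eqP; rewrite -subr_eq0; apply/eqP.
set d := _ - _.
have var s : 0 <= 2 * s * d + s ^+ 2 * ip h h.
  rewrite -[leRHS]addr0 -lerBlDl; apply/ler_addgt0Pl => e e0; rewrite addr0.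
  pose a := 2 * `|s| * snorm h + 1.
  have a0 : 0 < a by rewrite ltr_wpDl // !mulr_ge0 // snorm_ge0.
  have [|M1 H1] := small (e / 2); first by rewrite divr_gt0.
  have [|M2 H2] := pP (e / 2 / a); first by rewrite !divr_gt0.
  pose n := maxn M1 M2; have h1 := H1 n (leq_maxl _ _); have h2 := H2 n (leq_maxr _ _).
  have h3 := jJ (s *: h + u n); rewrite JD in h3; have h4 := uP n.
  move: h1 h4; move: (n.+1%:R^-1) => w h1 h4.
  have h5 : 2 * s * (ip (u n) h - ip p h) <= e / 2.
    rewrite -(bilBl ipP); apply: le_trans (_ : 2 * `|s| * snorm h * snorm (u n - p) <= _).
      rewrite -!mulrA ler_pM2l //; apply: le_trans (ler_norm _) _.
      rewrite normrM ler_wpM2l // ler_norml mulrC ip_le_snorm andbT lerNl -(bilNl ipP).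
      by rewrite opprB snormB ip_le_snorm.
    move: h2; rewrite ltr_pdivlMr // /a mulrDr mulr1 mulrC.
    by have := snorm_ge0 (u n - p); lra.
  rewrite /d; lra.
have hp : 0 < ip h h + 1 by rewrite ltr_wpDl.
have := var (- d / (ip h h + 1)).
have -> : 2 * (- d / (ip h h + 1)) * d + (- d / (ip h h + 1)) ^+ 2 * ip h h =
   - (d ^+ 2 * (ip h h + 2) / (ip h h + 1) ^+ 2).
  by field; rewrite gt_eqF.
rewrite oppr_ge0 pmulr_lle0 ?invr_gt0 ?exprn_gt0 // pmulr_lle0; last first.
  by have := ip_ge0 h; lra.
by move=> d0; apply/eqP; rewrite -sqrf_eq0 eq_le d0 sqr_ge0.
Qed.

(** * Gaps in the spectrum of a symmetric map *)

(** The form [ip] may have null vectors, as functions that vanish almost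
    everywhere are null in a space of functions; a symmetric map is linear only
    up to null vectors. *)
Definition symmetric_map (C : V -> V) := forall f g, ip (C f) g = ip f (C g).

Definition bounded_map (C : V -> V) :=
  exists2 L, 0 < L & forall f, ip (C f) (C f) <= L * ip f f.

Definition bounded_below (C : V -> V) :=
  exists2 k, 0 < k & forall f, k * ip f f <= ip (C f) (C f).

Definition same_class f g := forall h, ip f h = ip g h.

Lemma same_classE f g f' g' : same_class f f' -> same_class g g' ->
  ip f g = ip f' g'.
Proof. by move=> ff' gg'; rewrite ff' (bilC ipP) gg' (bilC ipP). Qed.

Lemma symmetric_map_shift C c : symmetric_map C ->
  symmetric_map (fun f => C f - c *: f).
Proof. by move=> Csym f g; rewrite !ipE Csym. Qed.

Lemma symmetric_map_sqr C : symmetric_map C -> symmetric_map (C \o C).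
Proof. by move=> Csym f g; rewrite /= !Csym. Qed.

Lemma ip_sub_le f g : ip (f - g) (f - g) <= 2 * ip f f + 2 * ip g g.
Proof.
have := ip_ge0 (f + g); rewrite !ipE (bilC ipP g f); lra.
Qed.

Lemma bounded_map_shift C c : bounded_map C ->
  bounded_map (fun f => C f - c *: f).
Proof.
move=> [L L0 HL]; exists (2 * L + 2 * c ^+ 2).
  by have := sqr_ge0 c; lra.
move=> f; apply: le_trans (ip_sub_le _ _) _; rewrite !ipE.
have -> : (2 * L + 2 * c ^+ 2) * ip f f = 2 * (L * ip f f) + 2 * (c * (c * ip f f)) by ring.
have := HL f; lra.
Qed.

Lemma bounded_map_sqr C : bounded_map C -> bounded_map (C \o C).
Proof.
move=> [L L0 HL]; exists (L * L); first exact: mulr_gt0.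
by move=> f; apply: le_trans (HL _) _; rewrite -mulrA ler_pM2l.
Qed.

Lemma bounded_below_comp C D : bounded_below C -> bounded_below D ->
  bounded_below (C \o D).
Proof.
move=> [k k0 Hk] [l l0 Hl]; exists (k * l); first exact: mulr_gt0.
by move=> f; apply: le_trans (Hk _); rewrite -mulrA ler_pM2l.
Qed.

Lemma bounded_below_eq C D : (forall f, same_class (C f) (D f)) ->
  bounded_below C -> bounded_below D.
Proof.
by move=> CD [k k0 Hk]; exists k => // f; rewrite -(same_classE (CD f) (CD f)).
Qed.

Lemma bounded_below_ext C D : (forall f, C f = D f) ->
  bounded_below C -> bounded_below D.
Proof. by move=> CD; apply: bounded_below_eq => f h; rewrite CD. Qed.

(** A difference of squares: [C^2 - s^2 = (C - s) (C + s)]. *)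
Lemma bounded_below_sqr C s : symmetric_map C ->
  bounded_below (fun f => C f - s *: f) -> bounded_below (fun f => C f + s *: f) ->
  bounded_below (fun f => C (C f) - s ^+ 2 *: f).
Proof.
move=> Csym Hm Hp; apply: bounded_below_eq (bounded_below_comp Hp Hm).
move=> f h /=; rewrite !ipE !Csym !ipE !Csym; ring.
Qed.

(** If [G] is nonnegative then [|G f|^2 <= L <G f, f>] by Cauchy-Schwarz for the
    form of [G], so being bounded below improves [0 <= G] to [k <= G]. *)
Lemma nonneg_bounded_below G : symmetric_map G -> bounded_map G ->
  (forall f, 0 <= ip (G f) f) -> bounded_below G ->
  exists2 k, 0 < k & forall f, k * ip f f <= ip (G f) f.
Proof.
move=> Gsym [L L0 HL] Gpos [k k0 Hk].
have fP : symmetric_bilinear (fun f g => ip (G f) g).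
  split=> [f g|a f g h]; first by rewrite Gsym (bilC ipP).
  by rewrite Gsym !ipE !Gsym.
have GL f : ip (G f) (G f) <= (L + 1) * ip (G f) f.
  have := @bil_Cauchy_Schwarz _ fP f (G f) (fun x y => Gpos _).
  have le1 : ip (G (G f)) (G f) <= (L + 1) * ip (G f) (G f).
    apply: le_trans (ip_le_snorm _ _) _.
    have := HL (G f); rewrite -!sqr_snorm => le2.
    have := sqr_ge0 (snorm (G (G f)) - snorm (G f)).
    have := mulr_ge0 (ltW L0) (sqr_ge0 (snorm (G f))).
    have := sqr_ge0 (snorm (G f)); lra.
  move=> cs; have [z|nz] := eqVneq (ip (G f) (G f)) 0.
    by rewrite z mulr_ge0 //; lra.
  have p : 0 < ip (G f) (G f) by rewrite lt_def nz ip_ge0.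
  rewrite -(ler_pM2r p) -expr2; apply: le_trans cs _.
  by rewrite [leRHS]mulrAC mulrC ler_wpM2r.
have L1 : 0 < L + 1 by lra.
exists (k / (L + 1)); first exact: divr_gt0.
move=> f; rewrite mulrAC ler_pdivrMr // mulrC [leRHS]mulrC mulrC.
exact: le_trans (Hk _) (GL _).
Qed.

(** The norm of the inverse of a symmetric map is the inverse of the distance
    from 0 to the spectrum. The best lower bound [beta] of [|D f|^2 / |f|^2]
    cannot be below [rho^2]: the nonnegative map [D^2 - beta] would be bounded
    below. *)
Lemma spectral_gap_center D rho : symmetric_map D -> bounded_map D -> 0 < rho ->
  (forall s, 0 <= s < rho -> bounded_below (fun f => D f - s *: f) /\
                             bounded_below (fun f => D f + s *: f)) ->
  forall f, rho ^+ 2 * ip f f <= ip (D f) (D f).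
Proof.
move=> Dsym Dbd rho0 Hs.
pose S := [set b : R | 0 <= b <= rho ^+ 2 /\
                       forall f, b * ip f f <= ip (D f) (D f)].
have S0 : S 0.
  by split=> [|f]; rewrite ?mul0r // lexx /= sqr_ge0.
have Sub : has_ubound S by exists (rho ^+ 2) => b [/andP[]].
have Ssup : has_sup S by split => //; exists 0.
pose be := sup S.
have be0 : 0 <= be by exact: ub_le_sup.
have beS f : be * ip f f <= ip (D f) (D f).
  have [->|nz] := eqVneq (ip f f) 0; first by rewrite mulr0.
  have p : 0 < ip f f by rewrite lt_def nz ip_ge0.
  rewrite -ler_pdivlMr //; apply: ge_sup; first by exists 0.
  by move=> b [_ Hb]; rewrite ler_pdivlMr.
have [le|lt] := leP (rho ^+ 2) be.
  by move=> f; apply: le_trans (beS f); rewrite ler_wpM2r.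
have s0 : 0 <= Num.sqrt be < rho.
  by rewrite sqrtr_ge0 /= -ltr_sqr ?nnegrE ?sqrtr_ge0 ?(ltW rho0) // sqr_sqrtr.
have [Hm Hp] := Hs _ s0.
have := bounded_below_sqr Dsym Hm Hp; rewrite sqr_sqrtr // => Gbb.
have Gsym := symmetric_map_shift be (symmetric_map_sqr Dsym).
have Gbd := bounded_map_shift be (bounded_map_sqr Dbd).
have [|k k0 Hk] := nonneg_bounded_below Gsym Gbd _ Gbb.
  by move=> f; rewrite !ipE /= Dsym subr_ge0.
suff : S (Num.min (be + k) (rho ^+ 2)).
  move=> /(ub_le_sup Sub); rewrite -/be ge_min => /orP[]; first lra.
  by rewrite leNgt lt.
split=> [|f].
  by rewrite le_min sqr_ge0 ge_min lexx orbT addr_ge0 // ltW.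
have := Hk f; rewrite !ipE /= Dsym => H.
apply: (@le_trans _ _ ((be + k) * ip f f)).
  by rewrite ler_wpM2r // ge_min lexx.
by rewrite mulrDl; lra.
Qed.

(** For an isolated point 0 of the spectrum of [C], the interval ]0, r^2[ is a
    gap for [B = C^2], so that [B (B - r^2) >= 0], which is the conclusion. *)
Lemma isolated_spectral_gap C (r : R) : symmetric_map C -> bounded_map C -> 0 < r ->
  (forall c, 0 < `|c| < r -> bounded_below (fun f => C f - c *: f)) ->
  forall f, r ^+ 2 * ip (C f) (C f) <= ip (C (C f)) (C (C f)).
Proof.
move=> Csym Cbd r0 Hc f.
have r20 : 0 < r ^+ 2 by rewrite exprn_gt0.
(* The centre of the gap is [r^2 / 2], which is also its half-width; the points
   [x] of the gap are regular for [C^2] as [+- sqrt x] are for [C]. *)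
have Dsym := symmetric_map_shift (r ^+ 2 / 2) (symmetric_map_sqr Csym).
have Dbd := bounded_map_shift (r ^+ 2 / 2) (bounded_map_sqr Cbd).
have sq x : 0 < x < r ^+ 2 -> bounded_below (fun f => C (C f) - x *: f).
  move=> /andP[x0 xr].
  have sx : 0 < Num.sqrt x < r.
    rewrite sqrtr_gt0 x0 /= -ltr_sqr ?nnegrE ?sqrtr_ge0 ?(ltW r0) //.
    by rewrite sqr_sqrtr ?(ltW x0).
  rewrite -[x]sqr_sqrtr ?(ltW x0) //; apply: bounded_below_sqr => //.
    by apply: Hc; rewrite ger0_norm ?sqrtr_ge0.
  apply: (@bounded_below_ext (fun g => C g - (- Num.sqrt x) *: g)).
    by move=> g; rewrite scaleNr opprK.
  by apply: Hc; rewrite normrN ger0_norm ?sqrtr_ge0.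
have := @spectral_gap_center _ (r ^+ 2 / 2) Dsym Dbd.
rewrite divr_gt0 // => /(_ isT) H.
have {H}/(_ f) : forall f, (r ^+ 2 / 2) ^+ 2 * ip f f <=
    ip ((C \o C) f - (r ^+ 2 / 2) *: f) ((C \o C) f - (r ^+ 2 / 2) *: f).
  apply: H => s /andP[s0 sr]; split.
    apply: (@bounded_below_ext (fun g => C (C g) - (r ^+ 2 / 2 + s) *: g)).
      by move=> g /=; rewrite scalerDl opprD addrA.
    by apply: sq; lra.
  apply: (@bounded_below_ext (fun g => C (C g) - (r ^+ 2 / 2 - s) *: g)).
    by move=> g /=; rewrite scalerDl opprD addrA scaleNr opprK.
  by apply: sq; lra.
rewrite /= !ipE (bilC ipP f (C _)) (Csym (C f) f).
have : r ^+ 2 / 2 * (r ^+ 2 / 2 * ip f f) = (r ^+ 2 / 2) ^+ 2 * ip f f by ring.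
move=> -> H; lra.
Qed.

(** The iterates of [1 - C^2 / M] contract the range of [C^2] and fix the kernel
    of [C]: they converge to an element of the kernel, which takes the place of
    the orthogonal projection. *)
Lemma almost_kernel_near_kernel C (r : R) : snorm_complete ->
  symmetric_map C -> bounded_map C -> 0 < r ->
  (forall f, r ^+ 2 * ip (C f) (C f) <= ip (C (C f)) (C (C f))) ->
  exists2 L, 0 < L & forall f, exists2 p, ip (C p) (C p) = 0 &
    snorm (f - p) <= L * snorm (C f).
Proof.
move=> Vcomp Csym [M0 M00 HM0] r0 gap.
pose M := M0 + r ^+ 2.
have r20 : 0 < r ^+ 2 by rewrite exprn_gt0.
have M_gt0 : 0 < M by rewrite addr_gt0.
have HM f : ip (C f) (C f) <= M * ip f f.
  by apply: le_trans (HM0 f) _; rewrite ler_wpM2r // /M lerDl ltW.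
pose q := Num.sqrt (1 - r ^+ 2 / M).
have q2 : q ^+ 2 = 1 - r ^+ 2 / M.
  rewrite sqr_sqrtr // subr_ge0 ler_pdivrMr // mul1r /M; lra.
have q_ge0 : 0 <= q by exact: sqrtr_ge0.
have q_lt1 : q < 1.
  rewrite -ltr_sqr ?nnegrE // q2 expr1n ltrBlDl ltrDr divr_gt0 //.
pose L := Num.sqrt M / M / (1 - q).
have L_gt0 : 0 < L by rewrite !divr_gt0 ?sqrtr_gt0 // subr_gt0.
exists L => // f.
pose B g := C (C g).
have Bsym : symmetric_map B by exact: symmetric_map_sqr.
(* [d n] is [M] times [u n - u n.+1]; it lies in the range of
   [C^2], where the gap makes [1 - C^2 / M] a contraction of factor [q]. *)
pose u := fix u n := if n is n'.+1 then u n' - M^-1 *: B (u n') else f.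
pose d n := B (u n).
have dS n : snorm (d n.+1) <= q * snorm (d n).
  rewrite -ler_sqr ?nnegrE ?mulr_ge0 ?snorm_ge0 // exprMn q2 !sqr_snorm.
  have -> : ip (d n.+1) (d n.+1) =
      ip (d n - M^-1 *: B (d n)) (d n - M^-1 *: B (d n)).
    by apply: same_classE => h; rewrite /d /= Bsym !ipE !Bsym.
  rewrite !ipE (bilC ipP (B _)).
  have -> : ip (d n) (B (d n)) = ip (C (d n)) (C (d n)) by rewrite /B Csym.
  have gap' : r ^+ 2 * ip (d n) (d n) <= ip (C (d n)) (C (d n)).
    apply: le_trans (gap (C (u n))) _.
    by rewrite /d /B.
  have BM : M^-1 * (M^-1 * ip (B (d n)) (B (d n))) <= M^-1 * ip (C (d n)) (C (d n)).
    rewrite ler_pM2l ?invr_gt0 // mulrC ler_pdivrMr // mulrC; exact: HM.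
  have gap2 : r ^+ 2 / M * ip (d n) (d n) <= M^-1 * ip (C (d n)) (C (d n)).
    by rewrite mulrAC mulrC ler_pM2l ?invr_gt0.
  rewrite mulrBl mul1r; lra.
have dn n : snorm (d n) <= q ^+ n * snorm (d 0).
  elim: n => [|n IH]; first by rewrite mul1r.
  apply: le_trans (dS n) _; rewrite exprS -mulrA; exact: ler_wpM2l.
pose A := snorm (d 0) / M.
have A_ge0 : 0 <= A by rewrite divr_ge0 ?snorm_ge0 // ltW.
have q1 : 0 < 1 - q by rewrite subr_gt0.
have step n : snorm (u n - u n.+1) <= A * q ^+ n.
  rewrite /= opprB addrC subrK snormZ ger0_norm ?invr_ge0 ?(ltW M_gt0) //.
  by rewrite /A mulrAC [leRHS]mulrC ler_pM2l ?invr_gt0 // mulrC; exact: dn.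
have tail n k : snorm (u n - u (n + k)%N) <= A / (1 - q) * (q ^+ n - q ^+ (n + k)).
  elim: k => [|k IH].
    by rewrite addn0 !subrr mulr0 /snorm (bil0l ipP) sqrtr0.
  apply: le_trans (snorm_triangle _ (u (n + k)%N) _) _; rewrite addnS.
  apply: le_trans (lerD IH (step _)) _.
  have -> : A * q ^+ (n + k) = A / (1 - q) * (q ^+ (n + k) - q ^+ (n + k).+1).
    by rewrite exprS; field; rewrite gt_eqF.
  by rewrite -mulrDr addrA subrK.
have Aq : 0 <= A / (1 - q) by rewrite divr_ge0 // ltW.
have tail' n k : snorm (u n - u (n + k)%N) <= A / (1 - q) * q ^+ n.
  apply: le_trans (tail n k) _; apply: ler_wpM2l => //.
  by rewrite gerBl exprn_ge0.
have qn : forall e, 0 < e -> exists M, forall n, (M <= n)%N -> q ^+ n < e.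
  move=> e e0.
  have : q ^+ n @[n --> \oo] --> (0 : R) by apply: cvg_expr; rewrite ger0_norm.
  move=> /cvgrPdist_lt /(_ e e0) [N _ HN]; exists N => n Nn.
  by have := HN n Nn; rewrite sub0r normrN ger0_norm ?exprn_ge0.
have qn' c : 0 <= c -> forall e, 0 < e -> exists M, forall n, (M <= n)%N -> c * q ^+ n < e.
  move=> c0 e e0; have c1 : 0 < c + 1 by lra.
  have [|K HK] := qn (e / (c + 1)); first exact: divr_gt0.
  exists K => n Kn; have := HK n Kn; rewrite ltr_pdivlMr // mulrDr mulr1 mulrC.
  have := exprn_ge0 n q_ge0; lra.
have [|p Hp] := Vcomp u.
  move=> e e0; have [K HK] := qn' _ Aq e e0; exists K => i j Ki Kj.
  wlog ij : i j Ki Kj / (i <= j)%N.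
    move=> W; have [|ji] := leqP i j; first exact: W.
    by rewrite snormB; apply: W => //; exact: ltnW.
  by rewrite -(subnKC ij); apply: le_lt_trans (tail' _ _) (HK _ _).
have eps0 (x : R) : 0 <= x -> (forall e, 0 < e -> x <= e) -> x = 0.
  move=> x0 H; apply/eqP; rewrite eq_le x0 andbT leNgt; apply/negP => xp.
  by have := H (x / 2) ltac:(lra); lra.
have CB x : snorm (B x) <= M * snorm x.
  rewrite -ler_sqr ?nnegrE ?mulr_ge0 ?snorm_ge0 ?(ltW M_gt0) // exprMn !sqr_snorm.
  apply: le_trans (HM _) _; rewrite expr2 -mulrA ler_pM2l //.
exists p.
  have Bp : snorm (B p) = 0.
    apply: eps0 => [|e e0]; first exact: snorm_ge0.
    have [|K HK] := Hp (e / 2 / M); first by rewrite !divr_gt0.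
    have [|K' HK'] := qn' _ (snorm_ge0 (d 0)) (e / 2); first by rewrite divr_gt0.
    pose n := maxn K K'.
    have -> : B p = (B p - B (u n)) + d n by rewrite subrK.
    apply: le_trans (snormD _ _) _.
    have -> : snorm (B p - B (u n)) = snorm (B (u n - p)).
      rewrite snormB /snorm; congr Num.sqrt; apply: same_classE => h;
      by rewrite !ipE !Bsym !ipE.
    have := HK n (leq_maxl _ _); rewrite ltr_pdivlMr // mulrC => h1.
    have := HK' n (leq_maxr _ _); rewrite mulrC => h2.
    have := CB (u n - p); have := dn n; lra.
  by rewrite Csym bilC // ip_null // -sqr_snorm Bp expr0n.
rewrite -[leRHS]addr0 -lerBlDl; apply/ler_addgt0Pl => e e0.
have [K HK] := Hp e e0; rewrite addr0 lerBlDl.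
apply: le_trans (snorm_triangle _ (u K) _) _.
rewrite lerD //; last by rewrite ltW // HK.
apply: le_trans (tail' 0 K) _; rewrite mulr1 /A /L mulrAC -[leRHS]mulrA mulrC.
have d0 : snorm (d 0) <= Num.sqrt M * snorm (C f).
  rewrite -ler_sqr ?nnegrE ?mulr_ge0 ?snorm_ge0 ?sqrtr_ge0 // exprMn !sqr_snorm.
  by rewrite sqr_sqrtr ?(ltW M_gt0) // HM.
rewrite mulrC !mulrA; rewrite [leLHS](_ : _ = snorm (d 0) * (M^-1 / (1 - q))); last by ring.
rewrite [leRHS](_ : _ = Num.sqrt M * snorm (C f) * (M^-1 / (1 - q))); last by ring.
by rewrite ler_wpM2r // divr_ge0 ?invr_ge0 // ltW.
Qed.

(** * The essential spectrum and Rayleigh quotients *)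

Definition in_kernel (C : V -> V) f := ip (C f) (C f) = 0.

Definition independent n (F : 'I_n -> V) := forall c : 'I_n -> R,
  ip (\sum_i c i *: F i) (\sum_i c i *: F i) = 0 -> forall i, c i = 0.

Definition finite_dimensional_kernel C :=
  exists n, ~ exists F : 'I_n -> V, (forall i, in_kernel C (F i)) /\ independent F.

(** A maximal independent family spans the kernel up to null vectors. *)
Lemma finite_dimensional_kernel_span C : finite_dimensional_kernel C ->
  exists gs : seq V, forall f, (forall g, g \in gs -> ip f g = 0) ->
    forall p, in_kernel C p -> ip f p = 0.
Proof.
move=> [n]; elim: n => [|n IH] Hn.
  by exfalso; apply: Hn; exists (fun=> 0); split=> [[]|c _ []].
have [ex|/IH//] := pselect (exists F : 'I_n -> V,
   (forall i, in_kernel C (F i)) /\ independent F).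
have [F [FC Find]] := ex.
exists [seq F i | i <- enum 'I_n] => f fF p pC.
have {}fF i : ip f (F i) = 0 by apply: fF; apply: map_f; rewrite mem_enum.
apply/eqP/negPn/negP => fp; apply: Hn.
exists (fun i => if unlift ord0 i is Some j then F j else p); split.
  by move=> i; case: unliftP => [j|] _.
move=> c; rewrite big_ord_recl unlift_none => c0.
have eqS : \sum_(i < n) c (lift ord0 i) *:
     (if unlift ord0 (lift ord0 i) is Some j then F j else p) =
     \sum_i c (lift ord0 i) *: F i.
  by apply: eq_bigr => i _; rewrite liftK.
rewrite eqS in c0.
have c00 : c ord0 = 0.
  have := ip_null f c0; rewrite (bilC ipP) !ipE (bilC ipP _ (\sum_i _)).
  rewrite (bil_suml ipP) big1 ?addr0 => [|i _]; last first.
    by rewrite (bilC ipP) fF mulr0.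
  by move=> /eqP; rewrite mulf_eq0 (negPf fp) orbF => /eqP.
rewrite c00 scale0r add0r in c0.
move=> i; have [j ->|->//] := unliftP ord0 i.
exact: Find c0 j.
Qed.

Lemma contraction_sqr T : symmetric_map T -> (forall f, 0 <= ip (T f) f) ->
  (forall f, ip (T f) f <= ip f f) -> forall f, ip (T f) (T f) <= ip f f.
Proof.
move=> Tsym Tpos Tle f.
have fP : symmetric_bilinear (fun f g => ip (T f) g).
  split=> [g h|a g g' h]; first by rewrite Tsym (bilC ipP).
  by rewrite Tsym !ipE !Tsym.
have cs := @bil_Cauchy_Schwarz _ fP f (T f) (fun x y => Tpos _).
have [z|nz] := eqVneq (ip (T f) (T f)) 0; first by rewrite z.
have p : 0 < ip (T f) (T f) by rewrite lt_def nz ip_ge0.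
rewrite -(ler_pM2r p) -expr2; apply: le_trans cs _.
apply: ler_pM => //; exact: Tle.
Qed.

(** Below, [tau] is the largest number that the Rayleigh quotient of [T] attains,
    up to an arbitrarily small error, on every subspace of finite codimension.
    On such a subspace where [T <= tau + eps], the Cauchy-Schwarz inequality
    for the form of [tau + eps - T] turns a vector that almost attains [tau]
    into an almost eigenvector. Were [tau] isolated in the spectrum with a
    finite dimensional eigenspace, an almost eigenvector orthogonal to this
    eigenspace would be close to it, which is absurd. *)
Theorem essential_spectrum_of_Rayleigh T (tau0 : R) : snorm_complete ->
  symmetric_map T -> (forall f, 0 <= ip (T f) f) ->
  (forall f, ip (T f) f <= ip f f) ->
  (forall (gs : seq V) (e : R), 0 < e ->
    exists f, [/\ 0 < ip f f, forall g, g \in gs -> ip f g = 0 &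
      (tau0 - e) * ip f f <= ip (T f) f]) ->
  0 <= tau0 ->
  exists tau, [/\ tau0 <= tau, tau <= 1 &
    (forall r, 0 < r -> exists2 c, 0 < `|c| < r &
       ~ bounded_below (fun f => T f - (tau + c) *: f)) \/
    ~ finite_dimensional_kernel (fun f => T f - tau *: f)].
Proof.
move=> Vcomp Tsym Tpos Tle Hlarge tau0_ge0.
pose S := [set t : R | exists gs : seq V, forall f,
   (forall g, g \in gs -> ip f g = 0) -> ip (T f) f <= t * ip f f].
have S1 : S 1 by exists [::] => f _; rewrite mul1r.
have Slb : lbound S tau0.
  move=> t [gs Hgs]; apply/ler_addgt0Pl => e e0.
  have [f [f0 fgs Hf]] := Hlarge gs e e0.
  have := le_trans Hf (Hgs f fgs); rewrite ler_pM2r //; lra.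
have Shas : has_inf S by split; [exists 1|exists tau0].
pose tau := inf S.
have tau_ge : tau0 <= tau by apply: lb_le_inf => //; exists 1.
have tau_le : tau <= 1 by apply: ge_inf => //; exists tau0.
exists tau; split=> //; apply: contrapT => /not_orP[Hisol /contrapT Hker].
have [r r0 Hr] : exists2 r, 0 < r & forall c, 0 < `|c| < r ->
    bounded_below (fun f => T f - (tau + c) *: f).
  apply: contrapT => H; apply: Hisol => r r0.
  apply: contrapT => H'; apply: H; exists r => // c cr.
  by apply: contrapT => H''; apply: H'; exists c.
pose C f := T f - tau *: f.
have Csym : symmetric_map C by exact: symmetric_map_shift.
have Cbd : bounded_map C.
  apply: bounded_map_shift; exists 1 => // f; rewrite mul1r.
  exact: contraction_sqr.
have gap := @isolated_spectral_gap C r Csym Cbd r0.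
have [|L L0 Hnear] := @almost_kernel_near_kernel C r Vcomp Csym Cbd r0.
  apply: gap => c cr; apply: bounded_below_ext (Hr c cr) => f.
  by rewrite /C scalerDl opprD addrA.
have [hs Hhs] := finite_dimensional_kernel_span Hker.
have [e [e0 e1 eL]] : exists e, [/\ 0 < e, e <= 1 & L ^+ 2 * (10 * e) < 1].
  have L2 : 0 < L ^+ 2 by rewrite exprn_gt0.
  exists (11 * L ^+ 2 + 1)^-1; have p : 0 < 11 * L ^+ 2 + 1 by lra.
  split; first by rewrite invr_gt0.
    by rewrite invf_le1 //; lra.
  by rewrite !mulrA ltr_pdivrMr //; lra.
have [t [gs Hgs] t_lt] := inf_adherent e0 Shas.
(* Orthogonality to [gs] and [T gs] keeps [w] below orthogonal to [gs], where
   the form of [tau + e - T] is nonnegative. *)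
pose ks := gs ++ map T gs ++ hs.
have [f fks Hf] : exists2 f, (forall g, g \in ks -> ip f g = 0) &
    (tau - e) * ip f f < ip (T f) f.
  apply: contrapT => H.
  have : S (tau - e).
    exists ks => f fks; rewrite leNgt; apply/negP => Hf.
    by apply: H; exists f.
  by move=> /(ge_inf (proj2 Shas)); rewrite -/tau; lra.
have fgs g : g \in gs -> ip f g = 0.
  by move=> gg; apply: fks; rewrite mem_cat gg.
have fTgs g : g \in gs -> ip f (T g) = 0.
  by move=> gg; apply: fks; rewrite !mem_cat (map_f T gg) orbT.
have f0 : 0 < ip f f.
  rewrite lt_def ip_ge0 andbT; apply/eqP => z.
  by move: Hf; rewrite z mulr0 (bilC ipP) (ip_null _ z) ltxx.
have [w wE] : exists w, w = (tau + e) *: f - T f by exists ((tau + e) *: f - T f).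
have wgs g : g \in gs -> ip w g = 0.
  by move=> gg; rewrite wE !ipE Tsym fgs // fTgs // mulr0 subr0.
pose b u v := (tau + e) * ip u v - ip (T u) v.
have bP : symmetric_bilinear b.
  rewrite /b; split=> [u v|a u v h]; first by rewrite (bilC ipP u) Tsym (bilC ipP u).
  by rewrite !Tsym !ipE; ring.
have bpos u : (forall g, g \in gs -> ip u g = 0) -> 0 <= b u u.
  move=> ugs; rewrite /b subr_ge0; apply: le_trans (Hgs u ugs) _.
  by rewrite ler_wpM2r // ltW.
have cs : b f w ^+ 2 <= b f f * b w w.
  apply: bil_Cauchy_Schwarz => // x y; apply: bpos => g gg.
  by rewrite !ipE fgs // wgs // !mulr0 addr0.
have bfw : b f w = ip w w by rewrite /b -(bilZl ipP) -(bilBl ipP) -wE.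
have bff : b f f <= 2 * e * ip f f by rewrite /b; move: Hf; rewrite !mulrDl; lra.
have bww : b w w <= 2 * ip w w.
  rewrite /b; have := Tpos w; have := ip_ge0 w => w0 Tw0.
  have : (tau + e) * ip w w <= 2 * ip w w by rewrite ler_wpM2r //; lra.
  by lra.
have ww : ip w w <= 4 * e * ip f f.
  have [->|nz] := eqVneq (ip w w) 0; first by rewrite !mulr_ge0 // ltW.
  have p : 0 < ip w w by rewrite lt_def nz ip_ge0.
  rewrite -(ler_pM2r p) -expr2 -{1}bfw; apply: le_trans cs _.
  rewrite [leRHS](_ : _ = (2 * e * ip f f) * (2 * ip w w)); last by ring.
  by apply: ler_pM => //; apply: bpos.
have Cf : ip (C f) (C f) <= 10 * e * ip f f.
  have -> : C f = e *: f - w.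
    by rewrite wE /C scalerDl opprB addrCA opprD [e *: f + _]addrCA subrr addr0.
  apply: le_trans (ip_sub_le _ _) _; rewrite !ipE mulrA.
  have : e * e * ip f f <= e * ip f f by rewrite ler_pM2r // ger_pMr.
  by lra.
have [p pC Hp] := Hnear f.
have fp : ip f p = 0.
  by apply: Hhs pC => g gg; apply: fks; rewrite !mem_cat gg !orbT.
have : snorm (f - p) ^+ 2 <= (L * snorm (C f)) ^+ 2.
  by rewrite ler_sqr ?nnegrE ?snorm_ge0 // mulr_ge0 ?snorm_ge0 // ltW.
rewrite exprMn !sqr_snorm (bilBl ipP f p) !(bilBr ipP f p) (bilC ipP p f) fp.
have : L ^+ 2 * ip (C f) (C f) <= L ^+ 2 * (10 * e) * ip f f.
  by rewrite -mulrA ler_wpM2l // sqr_ge0.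
have : L ^+ 2 * (10 * e) * ip f f < ip f f by rewrite gtr_pMl.
have := ip_ge0 p; lra.
Qed.

End SemiHilbert.

(** * Distortion coefficients *)

Section Distortion.
Context {R : realType}.
Implicit Types (K N t theta : R).

(** For [kappa < 0] and [x = sqrt (- kappa) * theta], the ratio [sinh (t x) / sinh x] is
    [exp (- (1 - t) x)] times [(1 - exp (- 2 t x)) / (1 - exp (- 2 x))], and the
    latter is at least [t] by convexity of the exponential. *)
Lemma sigma_ge (kappa t theta : R) : kappa <= 0 -> 0 <= t <= 1 -> 0 <= theta ->
  ((t * expR (- (Num.sqrt (- kappa) * theta)))%:E <= sigma kappa t theta)%E.
Proof.
move=> kappa0 /andP[t0 t1] th0; rewrite /sigma.
have e1 x : 0 <= x -> expR (- x) <= 1 by move=> x0; rewrite expR_le1 oppr_le0.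
have [->|thN0] := eqVneq theta 0.
  by rewrite mulr0 oppr0 expR0 mulr1.
have th_gt0 : 0 < theta by rewrite lt_def thN0.
rewrite ltNge kappa0 /= lee_fin /Defs.sfun !ltNge kappa0 /=.
have [->|kN0] := eqVneq kappa 0.
  by rewrite oppr0 sqrtr0 mul0r oppr0 expR0 mulr1 mulfK.
set a := Num.sqrt (- kappa).
have a0 : 0 < a by rewrite sqrtr_gt0 oppr_gt0 lt_def eq_sym kN0.
pose x := a * theta; have x0 : 0 < x by exact: mulr_gt0.
have -> : a * (t * theta) = t * x by rewrite /x mulrCA.
rewrite -/x.
have sinh_gt0 : 0 < expR x - expR (- x) by rewrite subr_gt0 ltr_expR; lra.
have -> : (expR (t * x) - expR (- (t * x))) / 2 / a / ((expR x - expR (- x)) / 2 / a) =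
    (expR (t * x) - expR (- (t * x))) / (expR x - expR (- x)).
  by field; rewrite !gt_eqF.
rewrite ler_pdivlMr //.
have cvx : expR (- (2 * (t * x))) <= (1 - t) + t * expR (- (2 * x)).
  have t01 : 0 <= t <= 1 by rewrite t0.
  have := @convex_expR R (Itv01 t0 t1) (- (2 * x)) 0.
  rewrite !convRE /= mulr0 addr0 expR0 mulr1 => H.
  apply: le_trans (_ : _ <= t * expR (- (2 * x)) + (1 - t)) _; last by lra.
  by move: H; rewrite mulrN mulrCA.
apply: (@le_trans _ _ (expR (t * x) * (t * (1 - expR (- (2 * x)))))).
  have -> : t * expR (- x) * (expR x - expR (- x)) = t * (1 - expR (- (2 * x))).
    rewrite mulrBr -!mulrA -!expRD addNr expR0 mulrBr; congr (_ - t * expR _); lra.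
  rewrite ler_peMl // ?mulr_ge0 ?subr_ge0 ?e1 //; try lra.
  by rewrite -expR0 ler_expR mulr_ge0 // ltW.
have -> : expR (t * x) - expR (- (t * x)) = expR (t * x) * (1 - expR (- (2 * (t * x)))).
  rewrite mulrBr mulr1 -expRD; congr (_ - expR _); lra.
rewrite ler_wpM2l ?expR_ge0 //; lra.
Qed.

Lemma tau_ge0 K N t theta : (0 <= tau K N t theta)%E.
Proof.
rewrite /tau; case: ifP => // _.
by rewrite mule_ge0 // ?lee_fin ?powR_ge0 // poweR_ge0.
Qed.

(** The exponents [1 / N] and [(N - 1) / N] of [t] add up to 1. *)
Lemma tau_ge K N t theta D : K <= 0 -> 1 < N -> 0 < t <= 1 -> 0 <= theta <= D ->
  ((t * expR (- (Num.sqrt (- (K / (N - 1))) * D * ((N - 1) / N))))%:E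
     <= tau K N t theta)%E.
Proof.
move=> K0 N1 /andP[t0 t1] /andP[th0 thD]; rewrite /tau gt_eqF //.
have N0 : 0 < N by lra.
have N10 : 0 < N - 1 by lra.
have k0 : K / (N - 1) <= 0 by rewrite ler_pdivrMr // mul0r.
set s := Num.sqrt _.
have s0 : 0 <= s by exact: sqrtr_ge0.
have := @sigma_ge (K / (N - 1)) t D k0.
have sg := @sigma_ge (K / (N - 1)) t theta k0.
rewrite (ltW t0) t1 /= in sg.
have {}sg := sg isT th0.
move=> _.
have lb : ((t * expR (- (s * D)))%:E <= sigma (K / (N - 1)) t theta)%E.
  apply: le_trans sg; rewrite lee_fin ler_wpM2l ?(ltW t0) // ler_expR lerN2.
  exact: ler_wpM2l.
have p0 : 0 <= t * expR (- (s * D)) by rewrite mulr_ge0 ?expR_ge0 // ltW.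
have := @gt0_ler_poweR _ ((N - 1) / N) (divr_ge0 (ltW N10) (ltW N0)) _ _ _ _ lb.
rewrite !in_itv /= !leey !andbT lee_fin p0 => /(_ isT (le_trans _ lb)).
rewrite lee_fin => /(_ p0) /= H.
apply: le_trans (lee_wpmul2l _ H); last by rewrite lee_fin powR_ge0.
rewrite -EFinM lee_fin powRM ?expR_ge0 ?(ltW t0) // [leRHS]mulrA -powRD; last first.
  by rewrite (gt_eqF t0) implybT.
rewrite -expRM.
have -> : N^-1 + (N - 1) / N = 1 by field; rewrite gt_eqF.
by rewrite powRr1 ?(ltW t0) // mulNr.
Qed.

End Distortion.

(** * Lower bounds of integrals, Borel sets and uniform measures *)

Section IntegralLowerBound.
Local Open Scope ereal_scope.

(** The integral of a nonnegative function is a supremum over the simple functions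
    below it, whether or not the function is measurable. *)
Lemma ge0_integral_ge_cst d (T : measurableType d) (R : realType)
    (mu : {measure set T -> \bar R}) (f : T -> \bar R) (E : set T) (c : R) :
  measurable E -> (0 <= c)%R -> (forall x, 0 <= f x) ->
  (forall x, E x -> c%:E <= f x) -> c%:E * mu E <= \int[mu]_x f x.
Proof.
move=> mE c0 f0 fE.
have -> : c%:E * mu E = \int[mu]_x (c * \1_E x)%:E.
  rewrite -[X in mu X]setIT -integral_indic // -ge0_integralZl_EFin //.
  by apply/measurable_EFinP; exact: measurable_indic.
rewrite !ge0_integralTE //; last by move=> x; rewrite lee_fin mulr_ge0.
apply: le_ereal_sup => _ [h hle <-]; exists h => // x.
apply: le_trans (hle x) _.
rewrite indicE; have [/set_mem Ex|_] := boolP (x \in E).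
  by rewrite mulr1 fE.
by rewrite mulr0.
Qed.

End IntegralLowerBound.

Lemma mnormalizeE d (T : measurableType d) (R : realType)
    (mu : {measure set T -> \bar R}) (P : probability T R) (B : set T) :
  (mu setT != 0)%E -> (mu setT != +oo)%E ->
  (mnormalize mu P B = mu B * (fine (mu setT))^-1%:E)%E.
Proof. by move=> /negPf mu0 /negPf muoo; rewrite /mnormalize mu0 muoo. Qed.

Section MetricBorel.
Context {R : realType} {X : completeMetricType R}.
Implicit Types (x y z : X) (r : R).

Lemma open_mdistP (A : set X) :
  (forall x, A x -> exists2 r, 0 < r & forall y, mdist x y < r -> A y) -> open A.
Proof.
move=> H; rewrite openE => x /H[r r0 rA].
rewrite /interior -nbhs_ballE; exists r => //= y.
by rewrite ballEmdist /=; exact: rA.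
Qed.

Lemma open_mball x r : open (ball x r).
Proof.
apply: open_mdistP => y; rewrite ballEmdist /= => xy.
exists (r - mdist x y) => [|z yz]; first by rewrite subr_gt0.
by apply: le_lt_trans (metric_triangle _ y _) _; rewrite addrC -ltrBrDr.
Qed.

Lemma open_borel (A : set X) : open A -> measurable (A : set (borel X)).
Proof. exact: (@sub_sigma_algebra _ setT (@open X)). Qed.

Lemma measurable_mball x r : measurable (ball x r : set (borel X)).
Proof. by apply: open_borel; exact: open_mball. Qed.

Lemma measurable_open_superlevel (f : borel X -> \bar R) :
  (forall c : R, open [set x : X | (c%:E < f x)%E]) -> measurable_fun setT f.
Proof.
move=> H; apply: (measurability _ (ErealGenOInfty.measurableE R)).
move=> _ [_ [c ->] <-]; rewrite setTI; apply: open_borel.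
rewrite (_ : _ @^-1` _ = [set x : X | (c%:E < f x)%E]) //.
by apply/seteqP; split => x /=; rewrite in_itv /= andbT.
Qed.

Definition Lipschitz (L : R) (f : X -> R) :=
  forall x y, `|f x - f y| <= L * mdist x y.

Lemma Lipschitz_open L (f : X -> R) (c : R) : Lipschitz L f ->
  open [set x | c < f x].
Proof.
move=> fL; apply: open_mdistP => x /= cf.
have p : 0 < `|L| + 1 by rewrite ltr_wpDl.
exists ((f x - c) / (`|L| + 1)); first by rewrite divr_gt0 // subr_gt0.
move=> y; rewrite ltr_pdivlMr // => xy.
have := le_trans (ler_norm _) (fL x y).
have : L * mdist x y <= (`|L| + 1) * mdist x y.
  by rewrite ler_wpM2r ?mdist_ge0 //; have := ler_norm L; lra.
by rewrite [X in _ <= X]mulrC; lra.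
Qed.

Lemma Lipschitz_measurable L (f : borel X -> R) :
  Lipschitz L f -> measurable_fun setT f.
Proof.
move=> fL; apply/measurable_EFinP; apply: measurable_open_superlevel => c.
rewrite (_ : [set x | _] = [set x | c < f x]); first exact: Lipschitz_open fL.
by apply/seteqP; split => x /=; rewrite lte_fin.
Qed.

Lemma Lipschitz_mdist x : Lipschitz 1 (mdist x).
Proof.
move=> y z; rewrite mul1r ler_norml; apply/andP; split.
  by have := metric_triangle x y z; lra.
by have := metric_triangle x z y; rewrite (metric_sym z y); lra.
Qed.

Lemma measurable_mdist x : measurable_fun setT (mdist x : borel X -> R).
Proof. exact: Lipschitz_measurable (Lipschitz_mdist x). Qed.

Variable m : {measure set (borel X) -> \bar R}.

Lemma uniform_probability (A : set (borel X)) x r :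
  measurable A -> A `<=` ball x r -> (0 < m A)%E -> (m A < +oo)%E ->
  exists mu : probability (borel X) R,
    [/\ has_density m mu (fun y => \1_A y / fine (m A)), P2 mu & mu A = 1%E].
Proof.
move=> mA Ar mA0 mAoo.
have mAfin : m A \is a fin_num by rewrite ge0_fin_numE.
have c0 : 0 < fine (m A) by rewrite fine_gt0 // mA0.
pose nu : {measure set (borel X) -> \bar R} := mrestr m mA.
have nuT : nu [set: borel X] = m A by rewrite /nu /= /mrestr setTI.
pose mu : probability (borel X) R := mnormalize nu (dirac (point : borel X)).
have muE B : mu B = (m (B `&` A) * (fine (m A))^-1%:E)%E.
  transitivity (mnormalize nu (dirac (point : borel X)) B) => //.
  by rewrite mnormalizeE ?nuT // ?(gt_eqF mA0) ?(lt_eqF mAoo).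
have muA : mu A = 1%E.
  by rewrite muE setIid -{1}(fineK mAfin) -EFinM mulfV // gt_eqF.
have muC : mu (~` A) = 0%E by rewrite muE setICl measure0 mul0e.
have dens : has_density m mu (fun y => \1_A y / fine (m A)).
  split.
  - by apply: measurable_funM => //; exact: measurable_indic.
  - by move=> y; rewrite divr_ge0 // ltW.
  - move=> B mB; rewrite muE.
    under eq_integral => y _ do rewrite mulrC EFinM.
    rewrite ge0_integralZl_EFin ?invr_ge0 ?(ltW c0) //.
      by rewrite integral_indic // setIC muleC.
    by apply/measurable_EFinP; exact: measurable_indic.
exists mu; split => //.
exists x.
have H : (\int[mu]_y (mdist x y ^+ 2)%:E <= \int[mu]_y (r ^+ 2)%:E)%E.
  apply: ae_ge0_le_integral => //.
  - by move=> y _; rewrite lee_fin sqr_ge0.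
  - apply/measurable_EFinP; apply: measurable_funX; exact: measurable_mdist.
  - by move=> y _; rewrite lee_fin sqr_ge0.
  - exists (~` A); split; first exact: measurableC.
      exact: muC.
    move=> y /= yn Ay; apply: yn => _; rewrite lee_fin.
    have := Ar _ Ay; rewrite ballEmdist /= => xy.
    by rewrite ler_sqr ?nnegrE ?mdist_ge0 ?(ltW xy) // (le_trans (mdist_ge0 x y)) // ltW.
apply: le_lt_trans H _.
by rewrite integral_cst //= [X in (_ * X)%E](probability_setT mu) mule1 ltry.
Qed.

End MetricBorel.

(** * Optimal transport and the growth of balls *)

(** Jensen's inequality, obtained by integrating Young's inequality
    [(c rho)^(1 - s) <= (1 - s) c rho + s] on [B], where [c] is the mass of [B]. *)
Lemma integral_powR_le d (T : measurableType d) (R : realType)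
    (mu : {measure set T -> \bar R}) (rho : T -> R) (B : set T) (s : R) :
  measurable B -> (0 < mu B)%E -> (mu B < +oo)%E -> 0 < s < 1 ->
  measurable_fun setT rho -> (forall x, 0 <= rho x) ->
  (\int[mu]_x (rho x)%:E <= 1)%E -> (\int[mu]_(x in ~` B) (rho x)%:E = 0)%E ->
  (\int[mu]_x (rho x `^ (1 - s))%:E <= (fine (mu B) `^ s)%:E)%E.
Proof.
move=> mB B0 Boo /andP[s0 s1] mrho rho0 rho1 rhoB.
have Bfin : mu B \is a fin_num by rewrite ge0_fin_numE.
set c := fine (mu B).
have c0 : 0 < c by rewrite fine_gt0 // B0.
have mrhoE : measurable_fun setT (fun x => (rho x)%:E) by exact/measurable_EFinP.
have m1B : measurable_fun setT (fun x => (\1_B x : R)%:E).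
  by apply/measurable_EFinP; exact: measurable_indic.
have young (a : R) : 0 <= a -> (a * c) `^ (1 - s) <= (1 - s) * (a * c) + s.
  move=> a0; have s1' : 0 < 1 - s by lra.
  have ac0 : 0 <= a * c by rewrite mulr_ge0 // ltW.
  have := @conjugate_powR R ((a * c) `^ (1 - s)) 1 (1 - s)^-1 s^-1.
  rewrite powR_ge0 ler01 !invr_gt0 s0 s1' !invrK subrK.
  move=> /(_ isT isT isT isT erefl).
  rewrite mulr1 -powRrM mulfV ?gt_eqF // powRr1 // powR1 /=; lra.
have ae0 : {ae mu, forall x, ~ B x -> rho x = 0}.
  have /ae_eq_integral_abs : measurable_fun (~` B) (fun x => (rho x)%:E).
    exact: measurable_funTS.
  move=> /(_ mu (measurableC mB)) [] + _.
  have -> : (\int[mu]_(x in ~` B) `|(rho x)%:E| = 0)%E.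
    by rewrite -rhoB; apply: eq_integral => x _; rewrite abse_EFin ger0_norm.
  move=> /(_ erefl); apply: filterS => x H Bx.
  by have := H Bx; case.
have H : (\int[mu]_x (rho x `^ (1 - s))%:E <=
   \int[mu]_x ((c `^ (s - 1))%:E * (((1 - s) * c)%:E * (rho x)%:E + s%:E * (\1_B x)%:E)))%E.
  apply: ae_ge0_le_integral => //.
  - by move=> x _; rewrite lee_fin powR_ge0.
  - by apply/measurable_EFinP; apply: measurableT_comp (measurable_powR _) mrho.
  - move=> x _; rewrite -!EFinM lee_fin mulr_ge0 ?powR_ge0 //.
    by rewrite addr_ge0 ?mulr_ge0 // ?subr_ge0 ltW.
  - apply: emeasurable_funM => //; apply: emeasurable_funD; exact: emeasurable_funM.
  apply: filterS ae0 => x Bx _; rewrite -!EFinM lee_fin.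
  have [xB|xNB] := boolP (x \in B).
    rewrite indicE xB /= mulr1.
    have := young _ (rho0 x); rewrite powRM // ?(ltW c0) // => Y.
    have cc : c `^ (s - 1) * c `^ (1 - s) = 1.
      by rewrite -powRD ?(gt_eqF c0) ?implybT // [X in c `^ X](_ : _ = 0) ?powRr0 //; ring.
    apply: le_trans (_ : c `^ (s - 1) * (rho x `^ (1 - s) * c `^ (1 - s)) <= _).
      by rewrite mulrCA cc mulr1.
    by rewrite ler_wpM2l ?powR_ge0 // -[(1 - s) * c * _]mulrA [c * _]mulrC.
  have nB : ~ B x by move=> /mem_set; exact/negP.
  rewrite (Bx nB) indicE (negPf xNB) powR0 ?gt_eqF ?subr_gt0 //.
  by rewrite !mulr0 addr0 mulr0.
apply: le_trans H _.
rewrite ge0_integralZl_EFin ?powR_ge0 //; last 2 first.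
- move=> x _; rewrite -!EFinM lee_fin.
  by rewrite addr_ge0 ?mulr_ge0 // ?subr_ge0 ltW.
- by apply: emeasurable_funD; exact: emeasurable_funM.
have s10 : 0 <= (1 - s) * c by rewrite mulr_ge0 ?ltW // subr_gt0.
have e1 x : setT x -> (0 <= ((1 - s) * c)%:E * (rho x)%:E)%E.
  by move=> _; rewrite -EFinM lee_fin mulr_ge0.
have e2 x : setT x -> (0 <= s%:E * (\1_B x : R)%:E)%E.
  by move=> _; rewrite -EFinM lee_fin mulr_ge0 // ltW.
have m1 := emeasurable_funM (measurable_cst (((1 - s) * c)%:E)) mrhoE.
have m2 := emeasurable_funM (measurable_cst (s%:E)) m1B.
rewrite (ge0_integralD _ measurableT e1 m1 e2 m2).
have r0 x : setT x -> (0 <= (rho x)%:E)%E by rewrite lee_fin.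
have i0 x : setT x -> (0 <= (\1_B x : R)%:E)%E by rewrite lee_fin.
rewrite (ge0_integralZl_EFin _ measurableT r0 mrhoE s10).
rewrite (ge0_integralZl_EFin _ measurableT i0 m1B (ltW s0)).
rewrite integral_indic // setIT -(fineK Bfin) -/c.
apply: (@le_trans _ _ ((c `^ (s - 1))%:E * (((1 - s) * c)%:E * 1 + s%:E * c%:E))%E).
  apply: lee_wpmul2l; first by rewrite lee_fin powR_ge0.
  by apply: leeD => //; apply: lee_wpmul2l.
rewrite mule1 -!EFinM lee_fin -mulrDl subrK mul1r.
by rewrite -{2}[c]powRr1 ?(ltW c0) // -powRD ?subrK // (gt_eqF c0) implybT.
Qed.

Section GeodesicEvaluation.
Context {R : realType} {X : completeMetricType R}.

Lemma open_geo_eval (t : {i01 R}) (U : set X) : open U ->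
  open ((@geo_eval R X t @^-1` U) : set (Geo X)).
Proof.
move=> oU; exists [set g : arrow_uniform_type {i01 R} X | U (g t)]; last by [].
rewrite openE => g /= Ugt.
have : nbhs (g t) U by exact: open_nbhs_nbhs.
rewrite /interior -!nbhs_ballE => -[e /= e0 eU]; exists e => //= h gh.
exact: eU (gh t).
Qed.

Lemma measurable_geo_eval (t : {i01 R}) (U : set X) : open U ->
  measurable (geo_eval t @^-1` U : set (borel (Geo X))).
Proof. by move=> oU; apply: sub_sigma_algebra; exact: open_geo_eval. Qed.

End GeodesicEvaluation.

Section BallGrowth.
Context {R : realType} {X : completeMetricType R}.
Variable m : {measure set (borel X) -> \bar R}.
Hypothesis Xm : metric_measure_space m.
Implicit Types (x : X) (r : R).

Lemma mball_gt0 x r : 0 < r -> (0 < m (ball x r))%E.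
Proof.
move=> r0; have [_ _ supp] := Xm.
have : msupport m x by rewrite supp.
by apply; split; [exact: open_mball|exact: ballxx].
Qed.

Lemma mball_lty x r : (m (ball x r) < +oo)%E.
Proof.
have [_ fin _] := Xm; apply: fin; first exact: measurable_mball.
by exists x, r.
Qed.

Lemma mball_fin_num x r : m (ball x r) \is a fin_num.
Proof. by rewrite ge0_fin_numE // mball_lty. Qed.

Definition mball x r := fine (m (ball x r)).

Lemma mballE x r : m (ball x r) = (mball x r)%:E.
Proof. by rewrite fineK ?mball_fin_num. Qed.

Lemma mball_pos x r : 0 < r -> 0 < mball x r.
Proof. by move=> r0; rewrite fine_gt0 // mball_gt0 // mball_lty. Qed.

Lemma geodesic_ball x r0 r1 (t : {i01 R}) (g : borel (Geo X)) :
  ball x r0 (geo_eval 0%:i01 g) -> ball x r1 (geo_eval 1%:i01 g) ->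
  ball x (r0 + t%:num * (r0 + r1)) (geo_eval t g).
Proof.
rewrite !ballEmdist /= => h0 h1.
have /set_mem gg := valP (g : Geo X).
have := gg 0%:i01 t; rewrite /= subr0 ger0_norm // => gt.
apply: le_lt_trans (metric_triangle _ (geo_eval 0%:i01 g) _) _.
rewrite /geo_eval gt ltr_leD // ler_wpM2l //.
apply: le_trans (metric_triangle _ x _) _; rewrite (metric_sym _ x).
by rewrite lerD // ltW.
Qed.

(** A crude Bishop-Gromov inequality. Along the transport from the uniform measure
    of a small ball to that of the large concentric ball, the mass lies in
    [ball x r] at time [t], and the distortion coefficient bounds how much the
    mass of the large ball was compressed. The factor in [t] is only polynomial,
    and the exponential rate is that of the space forms. *)
Lemma CD_ball_growth (K N : R) x r D (t : R) : CD m K N -> K <= 0 -> 1 < N ->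
  0 < r -> 0 < D -> 0 < t < 1 -> r / 2 + t * (r / 2 + D) <= r ->
  t `^ N * expR (- (Num.sqrt (- (K / (N - 1))) * (N - 1) * (r / 2 + D))) * mball x D
    <= mball x r.
Proof.
move=> cd K0 N1 r0 D0 /andP[t0 t1] tr.
have r20 : 0 < r / 2 by rewrite divr_gt0.
have N0 : 0 < N by lra.
set A0 : set (borel X) := ball x (r / 2); set A1 : set (borel X) := ball x D.
have [mu0 [d0 P20 mu0A]] := uniform_probability (measurable_mball x (r / 2))
  (@subset_refl _ _) (mball_gt0 x r20) (mball_lty _ _).
have [mu1 [d1 P21 mu1A]] := uniform_probability (measurable_mball x D)
  (@subset_refl _ _) (mball_gt0 x D0) (mball_lty _ _).
have [eta [mu [rho [p [Hmu _ Hp [[Hp0 Hp1] _] Hineq]]]]] := cd _ _ _ _ P20 P21 d0 d1.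
have mA0 : measurable A0 by exact: measurable_mball.
have mA1 : measurable A1 by exact: measurable_mball.
(* The optimal plan is carried by [A0 x A1], hence almost every geodesic joins
   the small ball to the large one. *)
pose E : set (borel X * borel X) := (fst @^-1` A0) `&` (snd @^-1` A1).
have mE0 : measurable (fst @^-1` A0 : set (borel X * borel X)).
  by rewrite -[X in measurable X]setTI; exact: measurable_fst.
have mE1 : measurable (snd @^-1` A1 : set (borel X * borel X)).
  by rewrite -[X in measurable X]setTI; exact: measurable_snd.
have mE : measurable E by exact: measurableI.
have pE : p E = 1%E.
  have /eqP : p (~` E) = 0%E.
    apply/eqP; rewrite eq_le measure_ge0 andbT setCI.
    apply: le_trans (measureU2 _ _ _) _; try exact: measurableC.
    have C0 : p (~` (fst @^-1` A0)) = 0%E.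
      by rewrite probability_setC // [p _](Hp0 _ mA0) mu0A subee.
    have C1 : p (~` (snd @^-1` A1)) = 0%E.
      by rewrite probability_setC // [p _](Hp1 _ mA1) mu1A subee.
    by rewrite [X in (X + _)%E]C0 [X in (_ + X)%E]C1 adde0.
  rewrite probability_setC // => /eqP; rewrite -(fineK (fin_num_measure p _ mE)).
  rewrite -EFinB => -[] /eqP; rewrite subr_eq0 => /eqP <-; by [].
pose T : {i01 R} := Itv01 (ltW t0) (ltW t1).
have TE : T%:num = t by [].
pose B : set (borel X) := ball x r.
have mB : measurable B by exact: measurable_mball.
have [muT [mrho rho0 rhoE]] := Hmu T.
have muB : mu T B = 1%E.
  apply/eqP; rewrite eq_le probability_le1 //= (muT _ mB) -pE (Hp _ mE).
  rewrite /pushforward; apply: le_measure.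
  - rewrite inE; have := measurableI _ _ (measurable_geo_eval 0%:i01 (open_mball x (r / 2)))
     (measurable_geo_eval 1%:i01 (open_mball x D)); exact.
  - by rewrite inE; exact: measurable_geo_eval (open_mball x r).
  - move=> g [/= g0 g1]; have := geodesic_ball T g0 g1; rewrite TE.
    by rewrite /B !ballEmdist /= => /lt_le_trans; apply.
have muC : mu T (~` B) = 0%E by rewrite probability_setC // muB subee.
have sN : 0 < N^-1 < 1 by rewrite invr_gt0 N0 invf_lt1.
have upper := integral_powR_le mB (mball_gt0 x r0) (mball_lty x r) sN mrho rho0.
have {}upper : (\int[m]_x0 (rho T x0 `^ (1 - N^-1))%:E <= (mball x r `^ N^-1)%:E)%E.
  apply: upper; first by rewrite -(rhoE _ measurableT) probability_setT.
  by rewrite -(rhoE _ (measurableC mB)) muC.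
have lower := Hineq T N (lexx _).
have {lower upper} := le_trans lower upper.
set k := Num.sqrt _.
pose q := t * expR (- (k * (r / 2 + D) * ((N - 1) / N))).
have q0 : 0 <= q by rewrite mulr_ge0 ?expR_ge0 // ltW.
have a0 := mball_pos x D0.
move=> main.
have : ((q * mball x D `^ N^-1)%:E * p E <= (mball x r `^ N^-1)%:E)%E.
  apply: le_trans main; apply: ge0_integral_ge_cst => //.
  - by rewrite mulr_ge0 ?powR_ge0.
  - by move=> z; rewrite adde_ge0 // mule_ge0 ?tau_ge0 // lee_fin powR_ge0.
  - move=> [y z] [/= y0 z1].
    rewrite -[X in (X <= _)%E]add0e; apply: leeD.
      by rewrite mule_ge0 ?tau_ge0 // lee_fin powR_ge0.
    have -> : \1_(ball x D) z / fine (m (ball x D)) = (mball x D)^-1.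
      by rewrite indicE mem_set // mul1r.
    rewrite -[(mball x D)^-1]powR_inv1 ?(ltW a0) // -powRrM mulN1r opprK EFinM.
    apply: lee_wpmul2r; first by rewrite lee_fin powR_ge0.
    apply: tau_ge => //; first by apply/andP; split=> //; exact: ltW.
    rewrite mdist_ge0 /=; move: y0 z1; rewrite /A0 /A1 !ballEmdist /= => y0 z1.
    apply: le_trans (metric_triangle _ x _) _; rewrite (metric_sym _ x).
    by rewrite lerD // ltW.
rewrite pE mule1 lee_fin => H.
have := ge0_ler_powR (ltW N0) _ _ H; rewrite !nnegrE mulr_ge0 ?powR_ge0 //.
move=> /(_ isT isT).
rewrite powRM ?powR_ge0 // -!powRrM mulVf ?gt_eqF //.
rewrite !powRr1 ?(ltW a0) ?(ltW (mball_pos x r0)) //.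
rewrite /q powRM ?expR_ge0 ?(ltW t0) // -expRM.
by congr (_ * expR _ * _ <= _); field; rewrite gt_eqF.
Qed.

End BallGrowth.

(** * Non-compact spaces are unbounded *)

(** Greedy choice: each term is separated from the list of the previous ones. *)
Lemma separated_sequence (T : eqType) (P : T -> T -> Prop) :
  (forall s : seq T, exists y, forall z, z \in s -> P z y) ->
  exists u : nat -> T, forall i j, (i < j)%N -> P (u i) (u j).
Proof.
move=> ext; have [f fP] := choice ext.
pose l := fix l n := if n is n'.+1 then f (l n') :: l n' else [::].
exists (fun n => f (l n)) => i j ij; apply: fP.
elim: j ij => // j IH; rewrite ltnS leq_eqVlt => /predU1P[->|/IH h] /=.
  by rewrite inE eqxx.
by rewrite inE h orbT.
Qed.

Lemma far_sequence (R : realType) (X : completeMetricType R) (r : R) :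
  (forall (x : X) D, exists y, D <= mdist x y) ->
  exists y : nat -> X, forall i j, (i < j)%N -> r <= mdist (y i) (y j).
Proof.
move=> far; apply: (@separated_sequence X (fun z y => r <= mdist z y)) => s.
have [y Hy] := far point (r + \sum_(z <- s) mdist (point : X) z).
exists y => z zs.
have : mdist (point : X) z <= \sum_(z <- s) mdist (point : X) z.
  by rewrite (big_rem z) //= lerDl sumr_ge0 // => w _; exact: mdist_ge0.
by have := metric_triangle (point : X) z y; lra.
Qed.

Section Unbounded.
Context {R : realType} {X : completeMetricType R}.

(** An ultrafilter contains a ball of each finite cover by balls, so it is a Cauchy
    filter. *)
Lemma totally_bounded_compact :
  (forall e : R, 0 < e ->
    exists s : seq X, forall y : X, exists2 z, z \in s & mdist z y < e) ->
  compact [set: X].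
Proof.
move=> tb; rewrite compact_ultra => F FU _.
have Fex : cauchy_ex F.
  move=> e e0; have [s sP] := tb e e0.
  apply: contrapT => /forallNP nF.
  have : F set0; last exact: filter_not_empty.
  have : F [set y | forall z, z \in s -> ~ ball z e y].
    elim: s {sP} => [|z s IH]; first by apply: filterS filterT => y _ z.
    have Fz : F (~` ball z e).
      by have [/nF//|] := in_ultra_setVsetC (ball z e) FU.
    apply: filterS (filterI Fz IH) => y [yz ys] w.
    by rewrite inE => /predU1P[->|/ys].
  apply: filterS => y yP; have [z zs zy] := sP y.
  by apply: yP zs _; rewrite ballEmdist.
have /cauchy_cvgP /cvg_ex [p Fp] : cauchy F by exact: cauchy_exP.
by exists p.
Qed.

Variable m : {measure set (borel X) -> \bar R}.
Hypothesis Xm : metric_measure_space m.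

(** In a bounded space, the growth of balls bounds below the mass of all balls
    of a given radius, hence bounds the number of disjoint ones. *)
Lemma CD_noncompact_unbounded (K N : R) : CD m K N -> K <= 0 -> 1 < N ->
  ~ compact [set: X] -> forall (x : X) (D : R), exists y, D <= mdist x y.
Proof.
move=> cd K0 N1 nc x0 D; apply: contrapT => /forallNP bd; apply: nc.
apply: totally_bounded_compact => e e0; apply: contrapT => /forallNP ns.
(* Otherwise some sequence is [e]-separated, and its balls of radius [e / 2] are
   disjoint. *)
have [|u uP] := @separated_sequence X (fun z y => e <= mdist z y).
  move=> s; have /existsNP [y yP] := ns s; exists y => z zs.
  by rewrite leNgt; apply/negP => zy; apply: yP; exists z.
have xD y : mdist x0 y < D by rewrite ltNge; apply/negP; exact: bd.
have D0 : 0 < D by apply: le_lt_trans (xD x0); exact: mdist_ge0.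
have ballT y : ball y (2 * D) = [set: X].
  apply/seteqP; split => // z _; rewrite ballEmdist /=.
  apply: le_lt_trans (metric_triangle _ x0 _) _; rewrite (metric_sym y).
  by have := xD y; have := xD z; lra.
pose r := e / 2; have r0 : 0 < r by rewrite divr_gt0.
pose t := r / 2 / (r / 2 + 2 * D).
have p0 : 0 < r / 2 + 2 * D by lra.
have t01 : 0 < t < 1.
  by rewrite /t !divr_gt0 //= ltr_pdivrMr // mul1r; lra.
have tr : r / 2 + t * (r / 2 + 2 * D) <= r by rewrite /t divfK ?gt_eqF //; lra.
have M0 := @mball_pos _ _ m Xm x0 (2 * D) ltac:(lra).
have {tr} growth y := @CD_ball_growth _ _ m Xm K N y r (2 * D) t cd K0 N1 r0 ltac:(lra) t01 tr.
pose c := t `^ N * expR (- (Num.sqrt (- (K / (N - 1))) * (N - 1) * (r / 2 + 2 * D))).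
have c0 : 0 < c by rewrite mulr_gt0 ?expR_gt0 // powR_gt0; case/andP: t01.
have {}growth (y : X) : ((c * mball m x0 (2 * D))%:E <= m (ball y r))%E.
  rewrite mballE // lee_fin /mball (_ : ball x0 (2 * D) = ball y (2 * D)).
    exact: growth.
  by rewrite !ballT.
have tI : trivIset setT (fun n => ball (u n) r : set (borel X)).
  apply: ltn_trivIset => i j ij; rewrite -subset0 => z [].
  rewrite !ballEmdist /= => zj zi; have := uP _ _ ij.
  apply/negP; rewrite -ltNge; apply: le_lt_trans (metric_triangle _ z _) _.
  by rewrite (metric_sym z); rewrite /r in zj zi; lra.
pose n := Num.Def.truncn c^-1.
have cn : c^-1 < n.+1%:R by exact: truncnS_gt.
have : (\sum_(i < n.+1) m (ball (u i) r) <= m (ball x0 (2 * D)))%E.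
  rewrite -(@measure_bigsetU _ _ _ m _ _ tI); last first.
    by move=> i; exact: measurable_mball.
  apply: le_measure; last by rewrite ballT.
    by rewrite inE; apply: bigsetU_measurable => i _; exact: measurable_mball.
  by rewrite inE; exact: measurable_mball.
apply/negP; rewrite -ltNge mballE //.
apply: lt_le_trans (_ : (\sum_(i < n.+1) (c * mball m x0 (2 * D))%:E <= _)%E); last first.
  by apply: lee_sum => i _; exact: growth.
rewrite sumEFin lte_fin sumr_const card_ord -[ltRHS]mulr_natl mulrA ltr_pMl //.
by rewrite -ltr_pdivrMr // mul1r.
Qed.

End Unbounded.

(** * Truncated exponentials of the distance *)

Section ExponentialGrowth.
Context {R : realType}.

Lemma expR_dominates_powR (N c C : R) : 0 < c -> 0 < C ->
  exists2 D, 2 <= D & (2 * D + 3) `^ N * expR (- (c * D)) <= C.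
Proof.
move=> c0 C0; pose n := (Num.Def.truncn N).+1.
have Nn : N <= n%:R by rewrite ltW // truncnS_gt.
pose a := c / 2; have a0 : 0 < a by rewrite divr_gt0.
pose F : R := (n.+1`!)%:R / a ^+ n.+1.
have F0 : 0 < F by rewrite divr_gt0 ?exprn_gt0 // ltr0n fact_gt0.
(* With [y = 2 D + 3], the exponential absorbs [y ^ n] and leaves [F / y]; the
   summand 7 ensures [2 <= D], and [3 a] comes from [c D = a (y - 3)]. *)
pose y := 7 + expR (3 * a) * F / C.
have y7 : 7 <= y by rewrite lerDl divr_ge0 ?(ltW C0) // mulr_ge0 ?expR_ge0 // ltW.
exists ((y - 3) / 2); first by lra.
have -> : 2 * ((y - 3) / 2) + 3 = y by field.
have -> : - (c * ((y - 3) / 2)) = 3 * a + - (a * y) by rewrite /a; field.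
rewrite expRD.
have y0 : 0 < y by lra.
have pw : y `^ N <= y ^+ n.
  by rewrite -powR_mulrn ?(ltW y0) // ler_powR //; lra.
have ex : (a * y) ^+ n.+1 / (n.+1)`!%:R <= expR (a * y).
  have := @expR_ge1Dxn R (a * y) n (mulr_ge0 (ltW a0) (ltW y0)); lra.
have f0 : 0 < ((n.+1)`!%:R : R) by rewrite ltr0n fact_gt0.
have {}ex : y ^+ n * expR (- (a * y)) <= F / y.
  rewrite expRN ler_pdivrMr ?expR_gt0 // mulrC.
  apply: le_trans (_ : (a * y) ^+ n.+1 / (n.+1)`!%:R * (F / y) <= _); last first.
    by rewrite ler_pM2r // divr_gt0.
  rewrite le_eqVlt; apply/orP; left; apply/eqP.
  rewrite /F exprMn [y ^+ n.+1]exprS; field.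
  by rewrite !gt_eqF //= exprn_gt0.
apply: (@le_trans _ _ (expR (3 * a) * (F / y))).
  rewrite mulrCA ler_pM2l ?expR_gt0 //; apply: le_trans ex.
  by rewrite ler_pM2r ?expR_gt0.
rewrite mulrA ler_pdivrMr // -ler_pdivrMl // [C^-1 * _]mulrC /y; lra.
Qed.

Lemma expRN_Lipschitz (b s t : R) : 0 <= b -> 0 <= s ->
  `|expR (- (b * t)) - expR (- (b * s))| <= b * `|t - s| * expR (- (b * Num.min s t)).
Proof.
move=> b0 s0.
wlog st : s t {s0} / s <= t.
  move=> W; case: (leP s t) => st; first by have := W s t st; rewrite min_l.
  by have := W t s (ltW st); rewrite min_l ?(ltW st) // distrC (distrC s).
rewrite min_l // (ger0_norm (_ : 0 <= t - s)) ?subr_ge0 // distrC ger0_norm; last first.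
  by rewrite subr_ge0 ler_expR lerN2 ler_wpM2l.
have -> : - (b * t) = - (b * s) + - (b * (t - s)) by ring.
rewrite expRD -[X in X - _]mulr1 -mulrBr mulrC ler_wpM2r ?expR_ge0 //.
have := expR_ge1Dx (- (b * (t - s))); lra.
Qed.

End ExponentialGrowth.

Section Cone.
Context {R : realType} {X : completeMetricType R}.
Implicit Types (b D : R) (x y z : X).

(** The exponential profile [exp (- b r)], of Rayleigh quotient at most [b^2],
    truncated to have bounded support; [cone_slope] bounds its slope. *)
Definition cone b D x y : R := Num.max (expR (- (b * mdist x y)) - expR (- (b * D))) 0.

Definition cone_slope b D x y : R :=
  if mdist x y <= D then b * expR (- (b * mdist x y)) else 0.

Lemma cone_ge0 b D x y : 0 <= cone b D x y.
Proof. by rewrite /cone le_max lexx orbT. Qed.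

Lemma cone_slope_ge0 b D x y : 0 <= b -> 0 <= cone_slope b D x y.
Proof. by move=> b0; rewrite /cone_slope; case: ifP => // _; rewrite mulr_ge0 ?expR_ge0. Qed.

Lemma cone_eq0 b D x y : 0 <= b -> D <= mdist x y -> cone b D x y = 0.
Proof.
by move=> b0 Dxy; rewrite /cone max_r // subr_le0 ler_expR lerN2 ler_wpM2l.
Qed.

Lemma maxr0_Lipschitz (s t : R) : `|Num.max s 0 - Num.max t 0| <= `|s - t|.
Proof.
have := ler_norm (t - s); have := ler_norm (s - t); rewrite (distrC t).
by case: (leP s 0) => s0; case: (leP t 0) => t0 h1 h2;
  rewrite ler_norml; apply/andP; split; lra.
Qed.

Lemma cone_diff b D x y z : 0 <= b ->
  `|cone b D x z - cone b D x y| <=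
    b * mdist y z * expR (- (b * Num.min (mdist x y) (mdist x z))).
Proof.
move=> b0; apply: le_trans (maxr0_Lipschitz _ _) _.
rewrite opprB addrA subrK.
apply: le_trans (@expRN_Lipschitz _ _ _ _ b0 (mdist_ge0 _ _)) _.
rewrite ler_wpM2r ?expR_ge0 // ler_wpM2l //.
by have := Lipschitz_mdist x z y; rewrite mul1r (metric_sym z y).
Qed.

Lemma cone_Lipschitz b D x : 0 <= b -> Lipschitz b (cone b D x).
Proof.
move=> b0 y z; rewrite distrC; apply: le_trans (cone_diff _ _ _ _ b0) _.
rewrite ler_piMr ?mulr_ge0 ?mdist_ge0 // expR_le1 oppr_le0 mulr_ge0 //.
by rewrite le_min !mdist_ge0.
Qed.

Lemma measurable_cone b D x : 0 <= b -> measurable_fun setT (cone b D x : borel X -> R).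
Proof. by move=> b0; exact: Lipschitz_measurable (cone_Lipschitz _ _ b0). Qed.

Lemma measurable_cone_slope b D x :
  measurable_fun setT (cone_slope b D x : borel X -> R).
Proof.
apply: measurable_fun_ifT => //.
- by apply: measurable_fun_ler => //; exact: measurable_mdist.
- apply: measurable_funM => //; apply: measurableT_comp => //.
  apply: measurableT_comp => //; apply: measurable_funM => //.
  exact: measurable_mdist.
Qed.

(** Within distance [r] of [y] the derivative of the exponential exceeds its value
    at [y] by a factor of at most [expR (b * r)], which tends to 1 with [r]. *)
Lemma cone_local_Lipschitz b D x y (e : R) : 0 < b -> 0 < e ->
  exists2 r, 0 < r & forall z, mdist y z < r ->
    `|cone b D x z - cone b D x y| <= (cone_slope b D x y + e) * mdist y z.
Proof.
move=> b0 e0; rewrite /cone_slope; case: (leP (mdist x y) D) => xyD; last first.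
  exists (mdist x y - D); first by rewrite subr_gt0.
  move=> z yz; have xz : D <= mdist x z.
    by have := metric_triangle x z y; rewrite (metric_sym z); lra.
  rewrite (cone_eq0 (ltW b0) xz) (cone_eq0 (ltW b0) (ltW xyD)) subrr normr0.
  by rewrite add0r mulr_ge0 ?mdist_ge0 // ltW.
have eb : 0 < e / b by rewrite divr_gt0.
pose r := ln (1 + e / b) / b.
have r0 : 0 < r by rewrite divr_gt0 // ln_gt0 // ltrDl.
exists r => // z yz; apply: le_trans (cone_diff _ _ _ _ (ltW b0)) _.
rewrite mulrAC ler_wpM2r ?mdist_ge0 //.
apply: (@le_trans _ _ (b * expR (- (b * mdist x y) + b * r))).
  rewrite ler_pM2l // ler_expR.
  have xz : mdist x y - r <= mdist x z.
    by have := metric_triangle x z y; rewrite (metric_sym z); lra.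
  have : mdist x y - r <= Num.min (mdist x y) (mdist x z) by rewrite le_min xz; lra.
  move=> /(ler_wpM2l (ltW b0)); lra.
have -> : b * r = ln (1 + e / b) by rewrite /r mulrC divfK // gt_eqF.
rewrite expRD lnK ?posrE; last by lra.
have : expR (- (b * mdist x y)) <= 1.
  by rewrite expR_le1 oppr_le0 mulr_ge0 ?mdist_ge0 // ltW.
have := expR_ge0 (- (b * mdist x y)).
move: (expR _) => E E0 E1.
have -> : b * (E * (1 + e / b)) = b * E + e * E by field; rewrite gt_eqF.
by rewrite lerD2l ler_piMr // ltW.
Qed.

Variable m : {measure set (borel X) -> \bar R}.
Hypothesis Xm : metric_measure_space m.

Lemma cone_energy_fin b D x : 0 <= b ->
  (\int[m]_y (cone b D x y ^+ 2)%:E < +oo)%E.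
Proof.
move=> b0.
have H : (\int[m]_y (cone b D x y ^+ 2)%:E <= \int[m]_y (\1_(ball x D) y)%:E)%E.
  apply: ge0_le_integral => //.
  - by move=> y _; rewrite lee_fin sqr_ge0.
  - by apply/measurable_EFinP; apply: measurable_funX; exact: measurable_cone.
  - by apply/measurable_EFinP; apply: measurable_indic; exact: measurable_mball.
  move=> y _; rewrite lee_fin indicE.
  have [yB|yB] := boolP (y \in _).
    rewrite expr_le1 ?cone_ge0 // /cone ge_max ler01 andbT.
    have := expR_ge0 (- (b * D)).
    have : expR (- (b * mdist x y)) <= 1.
      by rewrite expR_le1 oppr_le0 mulr_ge0 ?mdist_ge0.
    lra.
  rewrite cone_eq0 ?expr0n //.
  by rewrite leNgt; apply: contra yB => xy; rewrite inE ballEmdist.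
apply: le_lt_trans H _;
  rewrite integral_indic ?setIT; [exact: mball_lty|by []|exact: measurable_mball].
Qed.

Lemma cone_energy_ge b D x : 0 < b -> 1 <= D ->
  (((expR (- b) - expR (- (b * D))) ^+ 2 * mball m x 1)%:E <=
   \int[m]_y (cone b D x y ^+ 2)%:E)%E.
Proof.
move=> b0 D1; rewrite EFinM -mballE //; apply: ge0_integral_ge_cst.
- exact: measurable_mball.
- exact: sqr_ge0.
- by move=> y; rewrite lee_fin sqr_ge0.
- move=> y; rewrite ballEmdist /= => xy; rewrite lee_fin.
  have d0 : 0 <= expR (- b) - expR (- (b * D)).
    by rewrite subr_ge0 ler_expR lerN2 ler_pMr.
  rewrite ler_sqr ?nnegrE ?cone_ge0 // /cone le_max lerB //.
  by rewrite ler_expR lerN2 ler_piMr // ltW.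
Qed.

(** With [mu = sqrt (- K (N - 1))], balls grow at most like [expR (mu * r)], so
    for [b > mu / 2] the truncation error [expR (- 2 b D) * mball m x D] is
    negligible for large [D], uniformly in the centre; and [b^2] is close to
    [mu^2 / 4]. *)
Lemma cone_Rayleigh (K N e : R) : CD m K N -> K <= 0 -> 1 < N -> 0 < e ->
  exists b D, [/\ 0 < b, 1 < D & forall x,
    (\int[m]_y (cone_slope b D x y ^+ 2)%:E <=
     (- ((N - 1) * K / 4) + e)%:E * \int[m]_y (cone b D x y ^+ 2)%:E)%E].
Proof.
move=> cd K0 N1 e0.
have N10 : 0 < N - 1 by lra.
pose mu := Num.sqrt (- (K / (N - 1))) * (N - 1).
have mu0 : 0 <= mu by rewrite mulr_ge0 ?sqrtr_ge0 // ltW.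
have mu2 : mu ^+ 2 / 4 = - ((N - 1) * K / 4).
  rewrite /mu exprMn sqr_sqrtr; first by field; rewrite gt_eqF.
  by rewrite oppr_ge0 ler_pdivrMr // mul0r.
pose s := Num.min 1 (e / (2 * (mu + 1))).
have mu1 : 0 < 2 * (mu + 1) by lra.
have s0 : 0 < s by rewrite lt_min ltr01 divr_gt0.
have s1 : s <= 1 by rewrite ge_min lexx.
have se : s * (mu + 1) <= e / 2.
  have : s <= e / (2 * (mu + 1)) by rewrite ge_min lexx orbT.
  rewrite ler_pdivlMr //; lra.
pose b := mu / 2 + s.
have b0 : 0 < b by rewrite /b; lra.
have b2 : b ^+ 2 <= - ((N - 1) * K / 4) + e / 2.
  rewrite -mu2 /b; have : s * s <= s by rewrite ger_pMl.
  rewrite !expr2; lra.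
have b20 : 0 < b ^+ 2 by rewrite exprn_gt0.
pose h := e / (4 * b ^+ 2).
have h0 : 0 < h by rewrite divr_gt0 // mulr_gt0.
have hb : b ^+ 2 * (1 + 2 * h) <= - ((N - 1) * K / 4) + e.
  have : b ^+ 2 * (2 * h) = e / 2 by rewrite /h; field; rewrite gt_eqF.
  rewrite mulrDr mulr1; lra.
pose de := expR (- b) - expR (- (2 * b)).
have de0 : 0 < de by rewrite subr_gt0 ltr_expR; lra.
pose c := 2 * b - mu.
have c0 : 0 < c by rewrite /c /b; lra.
(* [h] is the weight in [(f + ka)^2 <= (1 + h) f^2 + (1 + 1/h) ka^2], where [ka]
   is the value at which the exponential is cut; [de] bounds below the cone on
   the unit ball. *)
pose C := h * de ^+ 2 / ((1 + h^-1) * expR (mu * (3 / 2))).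
have h1 : 0 < 1 + h^-1 by rewrite addr_gt0 // invr_gt0.
have hp : 0 <= 1 + h by lra.
have hip : 0 <= 1 + h^-1 := ltW h1.
have C0 : 0 < C by apply: divr_gt0; apply: mulr_gt0; rewrite ?exprn_gt0 ?expR_gt0.
have [D D2 HD] := @expR_dominates_powR _ N c C c0 C0.
exists b, D; split=> //; first by lra.
move=> x.
set I := (\int[m]_y (cone b D x y ^+ 2)%:E)%E.
have Ioo : (I < +oo)%E by exact: cone_energy_fin (ltW b0).
have I0 : (0 <= I)%E by apply: integral_ge0 => y _; rewrite lee_fin sqr_ge0.
have Ifin : I \is a fin_num by rewrite ge0_fin_numE.
pose ka := expR (- (b * D)).
have ka0 : 0 < ka by exact: expR_gt0.
have H : (\int[m]_y (cone_slope b D x y ^+ 2)%:E <=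
  \int[m]_y ((b ^+ 2 * (1 + h))%:E * (cone b D x y ^+ 2)%:E +
             (b ^+ 2 * (1 + h^-1) * ka ^+ 2)%:E * (\1_(ball x (D + 1)) y)%:E))%E.
  apply: ge0_le_integral => //.
  - by move=> y _; rewrite lee_fin sqr_ge0.
  - by apply/measurable_EFinP; apply: measurable_funX; exact: measurable_cone_slope.
  - apply: emeasurable_funD; apply: emeasurable_funM => //; apply/measurable_EFinP.
      by apply: measurable_funX; exact: measurable_cone (ltW b0).
    by apply: measurable_indic; exact: measurable_mball.
  move=> y _; rewrite -!EFinM lee_fin.
  have t1 : 0 <= b ^+ 2 * (1 + h) * cone b D x y ^+ 2.
    exact: mulr_ge0 (mulr_ge0 (sqr_ge0 _) hp) (sqr_ge0 _).
  have t2 : 0 <= b ^+ 2 * (1 + h^-1) * ka ^+ 2.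
    exact: mulr_ge0 (mulr_ge0 (sqr_ge0 _) hip) (sqr_ge0 _).
  rewrite /cone_slope; case: (leP (mdist x y) D) => xy; last first.
    by rewrite expr0n /= addr_ge0 // mulr_ge0 // indicE ler0n.
  rewrite indicE mem_set; last by rewrite ballEmdist /=; lra.
  have conv : expR (- (b * mdist x y)) = cone b D x y + ka.
    rewrite /cone max_l ?subrK // subr_ge0 ler_expR lerN2 ler_pM2l //.
  rewrite conv mulr1 exprMn -!(mulrA (b ^+ 2)) -mulrDr (ler_pM2l b20).
  move: (cone b D x y) => f.
  have : 0 <= h^-1 * (h * f - ka) ^+ 2 by rewrite mulr_ge0 ?sqr_ge0 // invr_ge0 ltW.
  have -> : h^-1 * (h * f - ka) ^+ 2 = h * f ^+ 2 - 2 * f * ka + h^-1 * ka ^+ 2.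
    by field; rewrite gt_eqF.
  lra.
apply: le_trans H _.
have nn1 : 0 <= b ^+ 2 * (1 + h) := mulr_ge0 (sqr_ge0 _) hp.
have nn2 : 0 <= b ^+ 2 * (1 + h^-1) * ka ^+ 2 :=
  mulr_ge0 (mulr_ge0 (sqr_ge0 _) hip) (sqr_ge0 _).
have mc : measurable_fun setT (fun y : borel X => (cone b D x y ^+ 2)%:E).
  by apply/measurable_EFinP; apply: measurable_funX; exact: measurable_cone (ltW b0).
have mi : measurable_fun setT (fun y : borel X => (\1_(ball x (D + 1)) y : R)%:E).
  by apply/measurable_EFinP; apply: measurable_indic; exact: measurable_mball.
have c_ge (y : borel X) : setT y -> (0 <= (cone b D x y ^+ 2)%:E)%E by rewrite lee_fin sqr_ge0.
have i_ge (y : borel X) : setT y -> (0 <= (\1_(ball x (D + 1)) y : R)%:E)%E by rewrite lee_fin.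
have m1 := emeasurable_funM (measurable_cst ((b ^+ 2 * (1 + h))%:E)) mc.
have m2 := emeasurable_funM (measurable_cst ((b ^+ 2 * (1 + h^-1) * ka ^+ 2)%:E)) mi.
have e1 (y : borel X) : setT y ->
    (0 <= (b ^+ 2 * (1 + h))%:E * (cone b D x y ^+ 2)%:E)%E.
  by move=> _; rewrite -EFinM lee_fin; exact: mulr_ge0 nn1 (sqr_ge0 _).
have e2 (y : borel X) : setT y ->
    (0 <= (b ^+ 2 * (1 + h^-1) * ka ^+ 2)%:E * (\1_(ball x (D + 1)) y : R)%:E)%E.
  by move=> _; rewrite -EFinM lee_fin mulr_ge0.
rewrite (ge0_integralD _ measurableT e1 m1 e2 m2).
rewrite (ge0_integralZl_EFin _ measurableT c_ge mc nn1).
rewrite (ge0_integralZl_EFin _ measurableT i_ge mi nn2).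
rewrite integral_indic ?setIT //; last exact: measurable_mball.
rewrite mballE // -/I -(fineK Ifin) -!EFinM -EFinD lee_fin.
have low : de ^+ 2 * mball m x 1 <= fine I.
  rewrite -lee_fin fineK //; apply: le_trans (cone_energy_ge x b0 _); last by lra.
  rewrite lee_fin ler_pM2r ?mball_pos // ler_sqr ?nnegrE ?(ltW de0) //.
    rewrite lerB // ler_expR lerN2 [leLHS]mulrC ler_pM2l //.
  by rewrite subr_ge0 ler_expR lerN2 ler_peMr ?(ltW b0) //; lra.
(* At this time, a geodesic of length at most [1 / 2 + (D + 1)] that starts in
   the ball of radius [1 / 2] has moved by at most [1 / 2]. *)
have t01 : 0 < (2 * D + 3)^-1 < 1.
  by rewrite invr_gt0 invf_lt1; lra.
have D10 : 0 < D + 1 by lra.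
have tr : 1 / 2 + (2 * D + 3)^-1 * (1 / 2 + (D + 1)) <= 1.
  have -> : 1 / 2 + (D + 1) = (2 * D + 3) / 2 by field.
  rewrite mulrA mulVf; first by lra.
  by rewrite gt_eqF //; lra.
have := @CD_ball_growth _ _ m Xm K N x 1 (D + 1) _ cd K0 N1 ltr01 D10 t01 tr.
rewrite -/mu => growth.
have yN0 : 0 < (2 * D + 3) `^ N by rewrite powR_gt0 //; lra.
have {}growth : mball m x (D + 1) <=
    (2 * D + 3) `^ N * expR (mu * (D + 3 / 2)) * mball m x 1.
  move: growth; have -> : (2 * D + 3)^-1 `^ N = ((2 * D + 3) `^ N)^-1.
    rewrite -(@powR_inv1 _ (2 * D + 3)); last by lra.
    by rewrite powRAC powR_inv1 // ltW.
  have -> : 1 / 2 + (D + 1) = D + 3 / 2 by field.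
  by rewrite expRN -invfM mulrC ler_pdivrMr ?mulr_gt0 ?expR_gt0 // mulrC.
have key : (1 + h^-1) * ka ^+ 2 * mball m x (D + 1) <= h * fine I.
  apply: le_trans (_ : h * (de ^+ 2 * mball m x 1) <= _); last by rewrite ler_pM2l.
  apply: (@le_trans _ _ ((1 + h^-1) * ka ^+ 2 *
     ((2 * D + 3) `^ N * expR (mu * (D + 3 / 2)) * mball m x 1))).
    by rewrite ler_wpM2l // mulr_ge0 ?sqr_ge0 // ltW.
  rewrite !(mulrA _ _ (mball m x 1)) ler_pM2r ?mball_pos //.
  move: HD; rewrite /C ler_pdivlMr ?mulr_gt0 ?expR_gt0 // => HD.
  apply: le_trans HD; rewrite le_eqVlt; apply/orP; left; apply/eqP.
  have -> : ka ^+ 2 = expR (- (2 * b * D)).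
    by rewrite /ka expr2 -expRD; congr expR; ring.
  have -> : expR (mu * (D + 3 / 2)) = expR (mu * D) * expR (mu * (3 / 2)).
    by rewrite -expRD -mulrDr.
  have -> : expR (- (c * D)) = expR (- (2 * b * D)) * expR (mu * D).
    by rewrite -expRD; congr expR; rewrite /c; ring.
  ring.
apply: (@le_trans _ _ (b ^+ 2 * (1 + 2 * h) * fine I)); last first.
  by rewrite ler_wpM2r // fine_ge0.
rewrite -!(mulrA (b ^+ 2)) -mulrDr (ler_pM2l b20).
move: key; lra.
Qed.

End Cone.

(** * The slope of a Lipschitz function *)

Section Slope.
Context {R : realType} {X : completeMetricType R}.
Implicit Types (f g : borel X -> R) (x y z : X).

Definition diff_quotient f x z : \bar R := (`|f z - f x| / mdist z x)%:E.

Lemma diff_quotient_ge0 f x z : (0 <= diff_quotient f x z)%E.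
Proof. by rewrite lee_fin divr_ge0 ?mdist_ge0. Qed.

Lemma slope_le f x (A : \bar R) r : 0 < r -> (0 <= A)%E ->
  (forall z, 0 < mdist x z < r -> (diff_quotient f x z <= A)%E) ->
  (slope f x <= A)%E.
Proof.
move=> r0 A0 fA; rewrite /slope; case: ifP => // _.
apply: (@le_trans _ _ (ereal_sup (diff_quotient f x @` [set z | 0 < mdist x z < r]))).
  apply: ereal_inf_lbound; exists [set z | 0 < mdist x z < r] => //.
  rewrite /dnbhs /within /= -nbhs_ballE; exists r => // z.
  by rewrite ballEmdist /= => xz zx; rewrite xz mdist_gt0 eq_sym zx.
by apply: ge_ereal_sup => _ [z /= zr <-]; exact: fA.
Qed.

Lemma slope_ge0 f x : (0 <= slope f x)%E.
Proof.
rewrite /slope; case: ifPn => // /asboolPn ni.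
apply: limf_esup_ge0 => [|z]; last exact: diff_quotient_ge0.
move=> x0; apply: ni; split; first by rewrite inE.
exists [set x]; last by rewrite setIT.
move: x0; rewrite /dnbhs /within /=; apply: filterS => z /= zx.
by apply: contrapT => /eqP /zx.
Qed.

(** The limit superior is an infimum of suprema over punctured neighbourhoods, so
    that a strict bound on it leaves room for a bound [B] valid on one of them. *)
Lemma slope_lt f x (A : \bar R) : (slope f x < A)%E ->
  exists r B, [/\ 0 < r, (0 <= B < A)%E &
    forall z, 0 < mdist x z < r -> (diff_quotient f x z <= B)%E].
Proof.
move=> sA; have A0 : (0 < A)%E := le_lt_trans (slope_ge0 f x) sA.
move: sA; rewrite /slope; case: ifPn => [/asboolP [_ [V xV VT]] _|_].
  move: xV; rewrite -nbhs_ballE => -[r /= r0 rV]; exists r, 0%E.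
  split=> //; first by rewrite lexx.
  move=> z /andP[z0 zr]; have : (V `&` setT) z.
    by split => //; apply: rV; rewrite ballEmdist.
  by rewrite VT /= => zx; move: z0; rewrite zx mdistxx ltxx.
move=> /ereal_inf_lt[_ [V xV <-] VA].
move: xV; rewrite /dnbhs /within /= -nbhs_ballE => -[r /= r0 rV].
exists r, (Order.max (ereal_sup (diff_quotient f x @` V)) 0%E).
split=> //; first by rewrite le_max lexx orbT /= gt_max VA.
move=> z /andP[z0 zr]; rewrite le_max; apply/orP; left.
apply: ereal_sup_ubound; exists z => //; apply: rV; first by rewrite ballEmdist.
by rewrite eq_sym -mdist_gt0.
Qed.

Lemma diff_quotient_le f x z (L : R) : 0 < mdist x z ->
  (diff_quotient f x z <= L%:E)%E = (`|f z - f x| <= L * mdist x z).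
Proof. by move=> xz; rewrite lee_fin (metric_sym z) ler_pdivrMr. Qed.

Lemma slope_le_fin f x (L : R) r : 0 < r -> 0 <= L ->
  (forall z, mdist x z < r -> `|f z - f x| <= L * mdist x z) ->
  (slope f x <= L%:E)%E.
Proof.
move=> r0 L0 fL; apply: (slope_le r0) => // z /andP[z0 zr].
by rewrite diff_quotient_le // fL.
Qed.

Lemma slope_lt_fin f x (L : R) : (slope f x < L%:E)%E ->
  exists2 r, 0 < r & forall z, mdist x z < r -> `|f z - f x| <= L * mdist x z.
Proof.
move=> /slope_lt[r [B [r0 /andP[B0 BL] fB]]]; exists r => // z zr.
have [zx|xz] := eqVneq x z; first by rewrite zx subrr normr0 mdistxx mulr0.
have p : 0 < mdist x z by rewrite mdist_gt0.
by rewrite -diff_quotient_le // (le_trans (fB z _)) ?p ?zr // ltW.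
Qed.

Lemma Lipschitz_slope_fin L f x : Lipschitz L f -> slope f x \is a fin_num.
Proof.
move=> fL; rewrite ge0_fin_numE ?slope_ge0 //.
apply: le_lt_trans (ltry `|L|); apply: (slope_le_fin ltr01) => // z _.
rewrite metric_sym; apply: le_trans (fL z x) _.
by rewrite ler_wpM2r ?mdist_ge0 // ler_norm.
Qed.

Lemma Lipschitz_scaleD L M (a : R) f g : Lipschitz L f -> Lipschitz M g ->
  Lipschitz (`|a| * L + M) (fun x => a * f x + g x).
Proof.
move=> fL gM x y; rewrite opprD addrACA -mulrBr.
apply: le_trans (ler_normD _ _) _; rewrite normrM mulrDl lerD //.
by rewrite -mulrA ler_wpM2l.
Qed.

Lemma slope_scaleD L M (a : R) f g x : Lipschitz L f -> Lipschitz M g ->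
  fine (slope (fun x => a * f x + g x) x) <= `|a| * fine (slope f x) + fine (slope g x).
Proof.
move=> fL gM; have ff := Lipschitz_slope_fin x fL; have gf := Lipschitz_slope_fin x gM.
have hf := Lipschitz_slope_fin x (Lipschitz_scaleD a fL gM).
apply/ler_addgt0Pr => e e0.
have p : 0 < `|a| + 1 by rewrite ltr_wpDl.
pose d := e / (`|a| + 1); have d0 : 0 < d by rewrite divr_gt0.
have sf : (slope f x < (fine (slope f x) + d)%:E)%E.
  by rewrite EFinD fineK // lteDl // lte_fin.
have sg : (slope g x < (fine (slope g x) + d)%:E)%E.
  by rewrite EFinD fineK // lteDl // lte_fin.
have [r r0 Hr] := slope_lt_fin sf; have [s s0 Hs] := slope_lt_fin sg.
have f0 : 0 <= fine (slope f x) by rewrite fine_ge0 ?slope_ge0.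
have g0 : 0 <= fine (slope g x) by rewrite fine_ge0 ?slope_ge0.
have -> : e = (`|a| + 1) * d by rewrite /d mulrC divfK // gt_eqF.
rewrite -lee_fin fineK //; apply: (@slope_le_fin _ _ _ (Num.min r s)).
- by rewrite lt_min r0.
- by rewrite !addr_ge0 ?mulr_ge0 // ltW.
- move=> z; rewrite lt_min => /andP[zr zs].
  rewrite opprD addrACA -mulrBr; apply: le_trans (ler_normD _ _) _.
  rewrite normrM; have := ler_wpM2l (normr_ge0 a) (Hr z zr); have := Hs z zs.
  lra.
Qed.

(** Adding the value 0 to the supremum makes the formula valid at the isolated
    points too. *)
Definition slope_scale f (r : R) x : \bar R :=
  ereal_sup ([set 0%E] `|` diff_quotient f x @` [set z | 0 < mdist x z < r]).

(** For each [z] the condition [c < diff_quotient f x z] is open in [x], hence a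
    supremum over [z] has open superlevel sets. *)
Lemma measurable_slope_scale L f r : Lipschitz L f ->
  measurable_fun setT (slope_scale f r : borel X -> \bar R).
Proof.
move=> fL; apply: (@measurable_open_superlevel _ _ (slope_scale f r)) => c.
have [c0|c0] := ltP c 0.
  rewrite (_ : [set x | _] = setT); first exact: openT.
  apply/seteqP; split=> // x _ /=; apply: (@lt_le_trans _ _ 0%E).
    by rewrite lte_fin.
  by apply: ereal_sup_ubound; left.
rewrite (_ : [set x | _] = \bigcup_z
  ([set x | 0 < mdist z x] `&` ball z r `&` [set x | 0 < `|f z - f x| - c * mdist z x])).
  apply: bigcup_open => z _; apply: openI.
    by apply: openI; [exact: Lipschitz_open (Lipschitz_mdist z)|exact: open_mball].
  apply: (@Lipschitz_open _ _ (L + `|c|)) => x y.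
  have : `|f z - f x| - `|f z - f y| <= L * mdist x y.
    have := ler_normD (f z - f y) (f y - f x); rewrite addrA subrK => H1.
    by have := fL y x; rewrite (metric_sym y); lra.
  have : `|f z - f y| - `|f z - f x| <= L * mdist x y.
    have := ler_normD (f z - f x) (f x - f y); rewrite addrA subrK => H1.
    by have := fL x y; lra.
  have h := Lipschitz_mdist z y x; rewrite mul1r (metric_sym y) in h.
  have : `|c * (mdist z y - mdist z x)| <= `|c| * mdist x y.
    by rewrite normrM ler_wpM2l.
  rewrite ler_norml => /andP[? ?] ? ?.
  by rewrite ler_norml mulrDl; apply/andP; split; lra.
apply/seteqP; split => x /=.
  move=> /ereal_sup_gt[_ [->|[z /= /andP[z0 zr] <-]]].
    by rewrite lte_fin ltNge c0.
  rewrite lte_fin => cq; exists z => //; rewrite ballEmdist /=.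
  rewrite (metric_sym z) z0 zr; split=> //.
  by move: cq; rewrite (metric_sym z) ltr_pdivlMr // subr_gt0.
move=> [z _ [[z0]]]; rewrite ballEmdist /= => zr.
rewrite subr_gt0 -ltr_pdivlMr // => cq.
apply: (@lt_le_trans _ _ (diff_quotient f x z)); first by rewrite lte_fin.
by apply: ereal_sup_ubound; right; exists z => //=; rewrite (metric_sym x) z0.
Qed.

Lemma slope_scale_inf f x :
  slope f x = einfs (fun n => slope_scale f n.+1%:R^-1 x) 0.
Proof.
apply/eqP; rewrite eq_le; apply/andP; split.
  apply: le_ereal_inf_tmp => _ [n _ <-].
  apply: (@slope_le _ _ _ n.+1%:R^-1); first by rewrite invr_gt0 ltr0n.
    by apply: ereal_sup_ubound; left.
  by move=> z zn; apply: ereal_sup_ubound; right; exists z.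
rewrite leNgt; apply/negP => /slope_lt[r [B [r0 /andP[B0 BA] fB]]].
pose n := Num.Def.truncn r^-1.
have nr : n.+1%:R^-1 < r by rewrite invf_plt ?posrE ?ltr0n // truncnS_gt.
move: BA; apply/negP; rewrite -leNgt.
apply: (@le_trans _ _ (slope_scale f n.+1%:R^-1 x)).
  by apply: ereal_inf_lbound; exists n.
apply: ge_ereal_sup => _ [->//|[z /= /andP[z0 zn] <-]].
by apply: fB; rewrite z0 (lt_trans zn).
Qed.

Lemma measurable_slope L f : Lipschitz L f ->
  measurable_fun setT (slope f : borel X -> \bar R).
Proof.
move=> fL; rewrite (_ : slope f = fun x => einfs (fun n => slope_scale f n.+1%:R^-1 x) 0).
  apply: (@measurable_fun_einfs _ (borel X) _ setT
    (fun n => slope_scale f n.+1%:R^-1 : borel X -> \bar R)).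
  by move=> n; exact: measurable_slope_scale fL.
by apply/funext => x; exact: slope_scale_inf.
Qed.

End Slope.

(** * Square-integrable functions *)

Lemma ecvg0P (R : realType) (w : nat -> \bar R) : (forall n, (0 <= w n)%E) ->
  w n @[n --> \oo] --> 0%E <->
  (forall e : R, 0 < e -> exists M, forall n, (M <= n)%N -> (w n < e%:E)%E).
Proof.
move=> w0; split=> [/fine_cvgP[[M1 _ fin] /cvgrPdist_lt wc] e e0|H].
  have [M2 _ H2] := wc e e0; exists (maxn M1 M2) => n.
  rewrite geq_max => /andP[n1 n2]; rewrite -(fineK (fin n n1)) lte_fin.
  have := H2 n n2; rewrite sub0r normrN; apply: le_lt_trans; exact: ler_norm.
have fin n (e : R) : (w n < e%:E)%E -> w n \is a fin_num.
  by move=> we; rewrite ge0_fin_numE // (lt_trans we) // ltry.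
apply/fine_cvgP; split.
  by have [M HM] := H 1 ltr01; exists M => // n /HM /fin.
apply/cvgrPdist_lt => e e0; have [M HM] := H e e0; exists M => // n /HM we.
rewrite sub0r normrN ger0_norm ?fine_ge0 //.
by rewrite -lte_fin fineK // (fin _ _ we).
Qed.

Section SquareIntegrable.
Context {R : realType} {X : completeMetricType R}.
Variable m : {measure set (borel X) -> \bar R}.
Implicit Types (f g h : borel X -> R).

Definition sqint f : \bar R := (\int[m]_x (f x ^+ 2)%:E)%E.

Lemma sqint_ge0 f : (0 <= sqint f)%E.
Proof. by apply: integral_ge0 => x _; rewrite lee_fin sqr_ge0. Qed.

Lemma L2normE f : L2norm m f = sqrte (sqint f).
Proof.
rewrite /L2norm unlock -poweR12_sqrt ?sqint_ge0 //; congr (_ `^ _)%E.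
apply: eq_integral => x _ /=.
by rewrite powR_mulrn // real_normK ?num_real.
Qed.

Lemma L2norm_sq f : (L2norm m f ^+ 2 = sqint f)%E.
Proof. by rewrite L2normE sqr_sqrte ?sqint_ge0. Qed.

Lemma L2P f : L2 m f <-> measurable_fun setT f /\ (sqint f < +oo)%E.
Proof.
have e : (L2norm m f < +oo)%E = (sqint f < +oo)%E.
  rewrite L2normE -ge0_fin_numE ?sqrte_ge0 // sqrte_fin_num ?sqint_ge0 //.
  by rewrite ge0_fin_numE ?sqint_ge0.
rewrite /L2 /=; split.
  by move=> /andP[]; rewrite !inE /= /finite_norm -e.
move=> [mf]; rewrite -e => fin.
by apply/andP; split; rewrite inE.
Qed.

Lemma measurable_sq f : measurable_fun setT f ->
  measurable_fun setT (fun x => (f x ^+ 2)%:E).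
Proof. by move=> mf; apply/measurable_EFinP; exact: measurable_funX. Qed.

Lemma sqint_scaleD (a : R) f g : measurable_fun setT f -> measurable_fun setT g ->
  (sqint (fun x => a * f x + g x)%R <=
     (2 * a ^+ 2)%:E * sqint f + 2%:E * sqint g)%E.
Proof.
move=> mf mg.
have a0 : 0 <= 2 * a ^+ 2 by rewrite mulr_ge0 // sqr_ge0.
have p1 (x : borel X) : setT x -> (0 <= (f x ^+ 2)%:E)%E by rewrite lee_fin sqr_ge0.
have p2 (x : borel X) : setT x -> (0 <= (g x ^+ 2)%:E)%E by rewrite lee_fin sqr_ge0.
have mf2 := measurable_sq mf; have mg2 := measurable_sq mg.
rewrite -(ge0_integralZl_EFin _ measurableT p1 mf2 a0).
rewrite -(ge0_integralZl_EFin _ measurableT p2 mg2 (ler0n _ 2)).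
rewrite -ge0_integralD //; last 4 first.
- by move=> x _; rewrite -EFinM lee_fin; exact: mulr_ge0 a0 (sqr_ge0 _).
- exact: emeasurable_funM.
- by move=> x _; rewrite -EFinM lee_fin; exact: mulr_ge0 (ler0n _ 2) (sqr_ge0 _).
- exact: emeasurable_funM.
apply: ge0_le_integral => //.
- by move=> x _; rewrite lee_fin sqr_ge0.
- apply: measurable_sq; apply: measurable_funD => //; exact: measurable_funM.
- by apply: emeasurable_funD; exact: emeasurable_funM.
move=> x _; rewrite -!EFinM lee_fin.
by have := sqr_ge0 (a * f x - g x); lra.
Qed.

Lemma sqint_lty f : L2 m f -> (sqint f < +oo)%E. Proof. by move=> /L2P[]. Qed.
Lemma L2_measurable f : L2 m f -> measurable_fun setT f.
Proof. by move=> /L2P[]. Qed.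
Lemma sqint_fin_num f : L2 m f -> sqint f \is a fin_num.
Proof. by move=> fL; rewrite ge0_fin_numE ?sqint_ge0 ?sqint_lty. Qed.

Lemma L2_scaleD (a : R) f g : L2 m f -> L2 m g -> L2 m (fun x => a * f x + g x).
Proof.
move=> /L2P[mf ff] /L2P[mg gf]; apply/L2P; split.
  by apply: measurable_funD => //; exact: measurable_funM.
apply: le_lt_trans (sqint_scaleD a mf mg) _.
by rewrite lte_add_pinfty // lte_mul_pinfty // lee_fin mulr_ge0 // sqr_ge0.
Qed.

Lemma L2_cst0 : L2 m (cst 0).
Proof.
apply/L2P; split=> //; rewrite /sqint.
by under eq_integral => x _ do rewrite expr0n; rewrite integral0.
Qed.

Lemma L2innerC f g : L2inner m f g = L2inner m g f.
Proof. by apply: eq_Rintegral => x _; rewrite mulrC. Qed.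

Lemma L2_integrableM f g : L2 m f -> L2 m g ->
  m.-integrable setT (EFin \o (fun x => f x * g x)).
Proof. by move=> fL gL; apply/Lfun1_integrable; exact: Lfun2_mul_Lfun1. Qed.

Lemma L2inner_scaleD (a : R) f g h : L2 m f -> L2 m g -> L2 m h ->
  L2inner m (fun x => a * f x + g x) h = a * L2inner m f h + L2inner m g h.
Proof.
move=> fL gL hL; have i1 := L2_integrableM fL hL; have i2 := L2_integrableM gL hL.
have i3 : m.-integrable setT (EFin \o (fun x => a * (f x * h x))).
  by apply: (integrableZl measurableT a i1).
rewrite /L2inner -(RintegralZl _ measurableT i1) -(RintegralD measurableT i3 i2).
by apply: eq_Rintegral => x _; rewrite mulrDl mulrA.
Qed.

Lemma L2inner_sq f : L2inner m f f = fine (sqint f).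
Proof. by []. Qed.

Lemma sqintE f : L2 m f -> sqint f = (L2inner m f f)%:E.
Proof. by move=> fL; rewrite L2inner_sq fineK ?sqint_fin_num. Qed.

Lemma L2inner_ge0 f : 0 <= L2inner m f f.
Proof. by rewrite L2inner_sq fine_ge0 // sqint_ge0. Qed.

Lemma L2norm_fin f : L2 m f -> L2norm m f = (Num.sqrt (L2inner m f f))%:E.
Proof. by move=> fL; rewrite L2normE sqintE. Qed.

Lemma L2norm_cvg0P (w : nat -> borel X -> R) :
  L2norm m (w n) @[n --> \oo] --> 0%E <->
  (forall e : R, 0 < e -> exists M, forall n, (M <= n)%N -> (sqint (w n) < e%:E)%E).
Proof.
have nrm n (e : R) : 0 < e -> (sqint (w n) < (e ^+ 2)%:E)%E = (L2norm m (w n) < e%:E)%E.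
  move=> e0; rewrite L2normE !ltNge -lee_sqrt ?sqint_ge0 // EFin_expe sqrte_sqr.
  by rewrite abse_EFin ger0_norm // ltW.
have p n : (0 <= L2norm m (w n))%E by rewrite L2normE sqrte_ge0.
split=> [/(ecvg0P p) H e e0|H].
  have s0 : 0 < Num.sqrt e by rewrite sqrtr_gt0.
  have [M HM] := H _ s0; exists M => n Mn.
  by rewrite -[e]sqr_sqrtr ?(ltW e0) // nrm // HM.
apply/(ecvg0P p) => e e0; have [M HM] := H _ (exprn_gt0 2 e0).
by exists M => n Mn; rewrite -nrm // HM.
Qed.

End SquareIntegrable.

(** * Functions of finite Cheeger energy *)

Section LiminfBounds.
Context {R : realType}.
Local Open Scope ereal_scope.

Lemma limn_einf_le (u : nat -> \bar R) C : (forall n, u n <= C) -> limn_einf u <= C.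
Proof.
move=> uC; rewrite limn_einf_lim; apply: lime_le; first exact: is_cvg_einfs.
apply: nearW => n; apply: le_trans (uC n); apply: ereal_inf_lbound.
by exists n => /=.
Qed.

Lemma limn_einf_lt (u : nat -> \bar R) C : limn_einf u < C ->
  forall n, exists2 k, (n <= k)%N & u k < C.
Proof.
move=> uC n; have : einfs u n < C.
  apply: le_lt_trans uC; rewrite limn_einf_lim (cvg_lim _ (@cvg_einfs_sup _ u)) //.
  by apply: ereal_sup_ubound; exists n.
by move=> /ereal_inf_lt[_ [k /= nk <-] ukC]; exists k.
Qed.

Lemma limn_einf_ge0 (u : nat -> \bar R) : (forall n, 0 <= u n) -> 0 <= limn_einf u.
Proof.
move=> u0; rewrite limn_einf_lim; apply: lime_ge; first exact: is_cvg_einfs.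
by apply: nearW => n; apply: le_ereal_inf_tmp => _ [k _ <-].
Qed.

End LiminfBounds.

Section CheegerEnergy.
Context {R : realType} {X : completeMetricType R}.
Variable m : {measure set (borel X) -> \bar R}.
Implicit Types (f g h : borel X -> R).

Definition slope_energy f : \bar R := (\int[m]_x slope f x ^+ 2)%E.

Lemma slope_energy_ge0 f : (0 <= slope_energy f)%E.
Proof. by apply: integral_ge0 => x _; rewrite expe_ge0 // slope_ge0. Qed.

Lemma Ch_ge0 f : (0 <= Ch m f)%E.
Proof.
apply: le_ereal_inf_tmp => _ [u _ <-]; apply: limn_einf_ge0 => n.
by rewrite mule_ge0 // slope_energy_ge0.
Qed.

Lemma Ch_le (u : nat -> borel X -> R) f C : (forall n, lipschitz_bs (u n)) ->
  L2norm m (u n \- f) @[n --> \oo] --> 0%E ->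
  (forall n, (2^-1%:E * slope_energy (u n) <= C)%E) -> (Ch m f <= C)%E.
Proof.
move=> uL uf uC; apply: ereal_inf_le.
exists (limn_einf (fun n => (2^-1%:E * slope_energy (u n))%E)).
  by exists u.
exact: limn_einf_le.
Qed.

Lemma Ch_le_slope f : lipschitz_bs f -> (Ch m f <= 2^-1%:E * slope_energy f)%E.
Proof.
move=> fL; apply: (@Ch_le (fun=> f)) => //.
apply/L2norm_cvg0P => e e0; exists 0%N => n _.
rewrite /sqint; under eq_integral => x _ do rewrite /= subrr expr0n /=.
by rewrite integral0 lte_fin.
Qed.

(** A finite Cheeger energy is witnessed by a sequence of bounded energy, so that
    two such sequences can be added. *)
Lemma Ch_lty f : (Ch m f < +oo)%E ->
  exists (u : nat -> borel X -> R) (C : R), [/\ forall n, lipschitz_bs (u n),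
    L2norm m (u n \- f) @[n --> \oo] --> 0%E &
    forall n, (slope_energy (u n) <= C%:E)%E].
Proof.
move=> /ereal_inf_lt[_ [u [uL uf] <-]] ltoo.
have [C HC] : exists C : R,
    (limn_einf (fun n => (2^-1%:E * slope_energy (u n))%E) < C%:E)%E.
  move: ltoo; set l := limn_einf _ => ltoo.
  have l0 : (0 <= l)%E.
    by apply: limn_einf_ge0 => n; rewrite mule_ge0 // slope_energy_ge0.
  by exists (fine l + 1); rewrite EFinD fineK ?ge0_fin_numE // lteDl ?ge0_fin_numE // lte_fin.
have H n : exists k, (n <= k)%N /\ (slope_energy (u k) <= (2 * C)%:E)%E.
  have [k nk kC] := limn_einf_lt HC n; exists k; split=> //.
  have := lee_wpmul2l (_ : (0 <= 2%:E)%E) (ltW kC).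
  by rewrite muleA -!EFinM divff // mul1e; apply; rewrite lee_fin.
have [k Hk] := choice H.
exists (u \o k), (2 * C); split => [n||n]; first exact: uL.
  apply/L2norm_cvg0P => e e0; have /L2norm_cvg0P/(_ e e0)[M HM] := uf.
  by exists M => n Mn; apply: HM; apply: leq_trans Mn _; case: (Hk n).
by have [] := Hk n.
Qed.

Lemma lipschitz_bs_Lipschitz f : lipschitz_bs f -> exists L, Lipschitz L f.
Proof. by move=> [[L fL] _]; exists L. Qed.

Lemma metric_boundedU (A B : set X) : metric_bounded A -> metric_bounded B ->
  metric_bounded (A `|` B).
Proof.
move=> [x [r Ar]] [y [s Bs]]; exists x, (Num.max r (mdist x y + s)).
move=> z [/Ar|/Bs]; rewrite !ballEmdist /= lt_max => h; first by rewrite h.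
apply/orP; right; apply: le_lt_trans (metric_triangle _ y _) _.
by rewrite ltrD2l.
Qed.

Lemma lipschitz_bs_scaleD a f g : lipschitz_bs f -> lipschitz_bs g ->
  lipschitz_bs (fun x => a * f x + g x).
Proof.
move=> [[L fL] fb] [[M gM] gb]; split.
  by exists (`|a| * L + M); exact: Lipschitz_scaleD.
have [x [r H]] := metric_boundedU fb gb; exists x, r => z Hz; apply: H.
rewrite -closureU; apply: closureS Hz => y /= H.
have [fy|] := eqVneq (f y) 0; [right|by left].
by apply: contra_neq H => gy; rewrite fy gy mulr0 addr0.
Qed.

Lemma lipschitz_bs_cst0 : lipschitz_bs (cst 0 : borel X -> R).
Proof.
split; first by exists 0 => x y; rewrite subrr normr0 mul0r.
exists point, 1 => x; rewrite (_ : [set _ | _] = set0) ?closure0 //.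
by apply/seteqP; split=> // y /=; rewrite eqxx.
Qed.

Lemma slope_energy_scaleD a f g : lipschitz_bs f -> lipschitz_bs g ->
  (slope_energy (fun x => a * f x + g x)%R <=
     (2 * a ^+ 2)%:E * slope_energy f + 2%:E * slope_energy g)%E.
Proof.
move=> /lipschitz_bs_Lipschitz[L fL] /lipschitz_bs_Lipschitz[M gM].
have sqE L' h : Lipschitz L' h -> slope_energy h = sqint m (fun x => fine (slope h x)).
  move=> hL; apply: eq_integral => x _; rewrite EFin_expe fineK //.
  exact: Lipschitz_slope_fin hL.
have meas L' h : Lipschitz L' h -> measurable_fun setT (fun x : borel X => fine (slope h x)).
  move=> hL; exact: measurableT_comp (measurable_slope hL).
have hL := Lipschitz_scaleD a fL gM.
rewrite (sqE _ _ hL) (sqE _ _ fL) (sqE _ _ gM).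
have -> : a ^+ 2 = `|a| ^+ 2 by rewrite real_normK ?num_real.
apply: le_trans (sqint_scaleD _ _ (meas _ _ fL) (meas _ _ gM)).
apply: ge0_le_integral => //.
- by move=> x _; rewrite lee_fin sqr_ge0.
- by apply: measurable_sq; exact: meas hL.
- apply: measurable_sq; apply: measurable_funD; last exact: meas gM.
  by apply: measurable_funM => //; exact: meas fL.
- move=> x _; rewrite lee_fin; have := slope_scaleD a x fL gM.
  have s0 h : 0 <= fine (slope h x) by rewrite fine_ge0 // slope_ge0.
  by move=> H; rewrite ler_sqr ?nnegrE ?addr_ge0 ?mulr_ge0.
Qed.

(** Only finiteness is at stake, so that [(s + t)^2 <= 2 s^2 + 2 t^2] is enough. *)
Lemma W12_scaleD a f g : W12 m f -> W12 m g -> W12 m (fun x => a * f x + g x).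
Proof.
move=> [fL /Ch_lty[u [C [uL uf uC]]]] [gL /Ch_lty[v [D [vL vg vD]]]].
split; first exact: L2_scaleD.
have a0 : 0 <= 2 * a ^+ 2 by rewrite mulr_ge0 // sqr_ge0.
apply: le_lt_trans (ltry (2^-1 * ((2 * a ^+ 2) * C + 2 * D))).
apply: (@Ch_le (fun n x => a * u n x + v n x)).
- by move=> n; exact: lipschitz_bs_scaleD.
- have meas (w : nat -> borel X -> R) h n : L2 m h -> lipschitz_bs (w n) ->
      measurable_fun setT (w n \- h).
    move=> hL /lipschitz_bs_Lipschitz[M wM]; apply: measurable_funB.
      exact: Lipschitz_measurable wM.
    exact: L2_measurable hL.
  move/L2norm_cvg0P : uf => uf; move/L2norm_cvg0P : vg => vg.
  apply/L2norm_cvg0P => e e0.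
  have p : 0 < 2 * a ^+ 2 + 1 by lra.
  have [|M1 H1] := uf (e / 2 / (2 * a ^+ 2 + 1)); first by rewrite !divr_gt0.
  have [|M2 H2] := vg (e / 4); first by rewrite divr_gt0.
  exists (maxn M1 M2) => n; rewrite geq_max => /andP[n1 n2].
  rewrite (_ : (fun x => a * u n x + v n x) \- (fun x => a * f x + g x) =
     fun x => a * (u n \- f) x + (v n \- g) x); last first.
    by apply/funext => x /=; ring.
  have H := sqint_scaleD m a (meas _ _ n fL (uL n)) (meas _ _ n gL (vL n)).
  apply: le_lt_trans H _.
  have h1 := H1 n n1; have h2 := H2 n n2.
  have s1 := sqint_ge0 m (u n \- f); have s2 := sqint_ge0 m (v n \- g).
  have f1 : sqint m (u n \- f) \is a fin_num by rewrite ge0_fin_numE // (lt_trans h1) // ltry.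
  have f2 : sqint m (v n \- g) \is a fin_num by rewrite ge0_fin_numE // (lt_trans h2) // ltry.
  move: h1 h2 s1 s2; rewrite -(fineK f1) -(fineK f2) -!EFinM -EFinD !lte_fin !lee_fin.
  rewrite ltr_pdivlMr // => h1 h2 s1 s2; lra.
- move=> n; rewrite EFinM; apply: lee_wpmul2l; first by rewrite lee_fin invr_ge0.
  apply: le_trans (slope_energy_scaleD a (uL n) (vL n)) _.
  apply: (@le_trans _ _ ((2 * a ^+ 2)%:E * C%:E + 2%:E * D%:E)%E); last by rewrite -!EFinM.
  by apply: leeD; apply: lee_wpmul2l => //; rewrite lee_fin.
Qed.

Lemma W12_cst0 : W12 m (cst 0).
Proof.
split; first exact: L2_cst0.
apply: le_lt_trans (Ch_le_slope lipschitz_bs_cst0) _.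
rewrite /slope_energy (_ : (\int[m]_x _ = 0)%E) ?mule0 ?ltry //.
rewrite -[RHS](integral0 m setT); apply: eq_integral => x _.
have -> : slope (cst 0 : borel X -> R) x = 0%E; last by rewrite expe2 mul0e.
apply/eqP; rewrite eq_le slope_ge0 andbT; apply: (slope_le_fin ltr01) => // z _.
by rewrite subrr normr0 mul0r.
Qed.

Lemma lipschitz_bs_W12 f : lipschitz_bs f -> L2 m f -> (slope_energy f < +oo)%E ->
  W12 m f.
Proof.
move=> fl fL fe; split=> //; apply: le_lt_trans (Ch_le_slope fl) _.
by rewrite lte_mul_pinfty // lee_fin invr_ge0.
Qed.

End CheegerEnergy.

(** * The Hilbert space of functions of finite energy *)

Section W12Space.
Context {R : realType} {X : completeMetricType R}.
Variable m : {measure set (borel X) -> \bar R}.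

Definition W12_mem : {pred (borel X -> R)} := mem (W12 m).

Lemma W12_submod_closed : submod_closed W12_mem.
Proof.
split; first by apply/mem_set; exact: W12_cst0.
by move=> a f g /set_mem fW /set_mem gW; apply/mem_set; exact: W12_scaleD.
Qed.

HB.instance Definition _ := GRing.isSubmodClosed.Build R (borel X -> R) W12_mem
  W12_submod_closed.

(** Functions rather than classes: functions that are equal almost everywhere
    differ by a null vector of the semi-inner products below. *)
Record W12_space := MkW12 { W12_val : borel X -> R; _ : W12_val \in W12_mem }.

HB.instance Definition _ := [isSub for W12_val].
HB.instance Definition _ := [Choice of W12_space by <:].
HB.instance Definition _ := [SubChoice_isSubLmodule of W12_space by <:].

Lemma W12_valP (f : W12_space) : W12 m (W12_val f).
Proof. by case: f => f /= /set_mem. Qed.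

Lemma W12_val_scaleD a (f g : W12_space) :
  W12_val (a *: f + g) = (fun x => a * W12_val f x + W12_val g x).
Proof. by []. Qed.

Lemma W12_valB (f g : W12_space) : W12_val (f - g) = (W12_val f \- W12_val g).
Proof. by []. Qed.

Lemma W12_val_sum n (c : 'I_n -> R) (F : 'I_n -> W12_space) :
  W12_val (\sum_i c i *: F i) = (fun x => \sum_i c i * W12_val (F i) x).
Proof.
apply/funext => x.
suff -> : W12_val (\sum_i c i *: F i) = \sum_i c i *: W12_val (F i).
  by rewrite fct_sumE; apply: eq_bigr => i _.
exact: (big_morph W12_val (id1 := 0) (op1 := +%R)).
Qed.

Lemma W12_L2 (f : W12_space) : L2 m (W12_val f). Proof. by case: (W12_valP f). Qed.

Definition W12_L2inner (f g : W12_space) := L2inner m (W12_val f) (W12_val g).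

Lemma W12_L2inner_symmetric : symmetric_bilinear W12_L2inner.
Proof.
split=> [f g|a f g h]; first exact: L2innerC.
by rewrite /W12_L2inner W12_val_scaleD L2inner_scaleD //; exact: W12_L2.
Qed.

Variable ip : (borel X -> R) -> (borel X -> R) -> R.
Hypothesis ipP : W12_inner_product m ip.

Definition W12_form (f g : W12_space) := ip (W12_val f) (W12_val g).

Lemma W12_form_symmetric : symmetric_bilinear W12_form.
Proof.
have [ipC ipD _] := ipP; split=> [f g|a f g h].
  by apply: ipC; exact: W12_valP.
by rewrite /W12_form W12_val_scaleD ipD //; exact: W12_valP.
Qed.

Lemma W12_formE (f : W12_space) :
  (W12_form f f)%:E = ((W12_L2inner f f)%:E + 2%:E * Ch m (W12_val f))%E.
Proof.
have [_ _ ipN] := ipP; rewrite /W12_form -ipN; last exact: W12_valP.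
rewrite /W12norm sqr_sqrte ?L2norm_sq ?sqintE //; try exact: W12_L2.
by rewrite adde_ge0 ?lee_fin ?L2inner_ge0 // mule_ge0 // Ch_ge0.
Qed.

Lemma W12_ChE (f : W12_space) :
  Ch m (W12_val f) = ((W12_form f f - W12_L2inner f f) / 2)%:E.
Proof.
have fin : Ch m (W12_val f) \is a fin_num.
  by rewrite ge0_fin_numE ?Ch_ge0 //; case: (W12_valP f).
have := W12_formE f; rewrite -(fineK fin) -EFinM -EFinD => -[->].
by congr (_%:E); field.
Qed.

Lemma W12_form_ge (f : W12_space) : W12_L2inner f f <= W12_form f f.
Proof.
have := Ch_ge0 m (W12_val f); rewrite W12_ChE lee_fin; lra.
Qed.

Lemma W12_form_ge0 (f : W12_space) : 0 <= W12_form f f.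
Proof. exact: le_trans (L2inner_ge0 _ _) (W12_form_ge f). Qed.

Lemma W12_normE (f : W12_space) :
  W12norm m (W12_val f) = (@snorm R W12_space W12_form f)%:E.
Proof.
have [_ _ ipN] := ipP; have := ipN _ (W12_valP f).
rewrite /W12norm sqr_sqrte => [->//|].
by rewrite adde_ge0 ?expe_ge0 ?L2normE ?sqrte_ge0 // mule_ge0 // Ch_ge0.
Qed.

Lemma W12_snorm_complete : W12_complete m -> @snorm_complete R W12_space W12_form.
Proof.
move=> Wc u uC.
have [|e e0|f fW uf] := Wc (fun n => W12_val (u n)).
- by move=> n; exact: W12_valP.
- have [M HM] := uC e e0; exists M => i j Mi Mj.
  by rewrite -W12_valB W12_normE lte_fin HM.
pose F := MkW12 (mem_set fW : f \in W12_mem).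
exists F => e e0.
have p n : (0 <= W12norm m (W12_val (u n) \- f)%R)%E by rewrite /W12norm sqrte_ge0.
have /(ecvg0P p)/(_ e e0)[M HM] := uf.
by exists M => n Mn; rewrite -lte_fin -W12_normE; exact: HM.
Qed.

(** The weak form [<u, h>_W12 = <w, h>_L2] of the equation [u - Delta u = w]: as
    [Ch] is a quadratic form, expanding it around [u] gives the subdifferential
    inequality. *)
Lemma weak_neg_laplacian (u : W12_space) (w : borel X -> R) : L2 m w ->
  (forall h, W12_form u h = L2inner m w (W12_val h)) ->
  neg_laplacian m (W12_val u) (fun x => - 1 * W12_val u x + w x).
Proof.
move=> wL uw; have uL := W12_L2 u; split=> //.
- exact: L2_scaleD.
- by case: (W12_valP u).
move=> h hL; have [->|hfin] := eqVneq (Ch m h) +oo%E; first by rewrite leey.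
have hW : W12 m h by split; rewrite ?ltey.
pose H := MkW12 (mem_set hW : h \in W12_mem).
have -> : h = W12_val H by [].
rewrite -W12_valB !W12_ChE -EFinD lee_fin L2inner_scaleD //; last exact: W12_L2.
rewrite -uw; have [k ->] : exists k, H = k + u by exists (H - u); rewrite subrK.
rewrite addrK.
rewrite !(bilE W12_form_symmetric) !(bilE W12_L2inner_symmetric).
have := W12_form_ge k; rewrite (bilC W12_form_symmetric k u).
rewrite (bilC W12_L2inner_symmetric k u) -/(W12_L2inner u k).
lra.
Qed.

Hypothesis Wc : W12_complete m.

Lemma W12_resolvent_exists (f : W12_space) :
  exists u, forall h, W12_form u h = W12_L2inner f h.
Proof.
apply: (@Riesz_representation R W12_space W12_form W12_form_symmetric W12_form_ge0
  (W12_L2inner f) (W12_L2inner f f) (W12_snorm_complete Wc)).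
  move=> a g g' /=; rewrite !(bilC W12_L2inner_symmetric f).
  exact: bilPl W12_L2inner_symmetric _ _ _ _.
move=> g; apply: (@le_trans _ _ (W12_L2inner f f * W12_L2inner g g)).
  apply: (bil_Cauchy_Schwarz W12_L2inner_symmetric) => x y; exact: L2inner_ge0.
by rewrite ler_wpM2l ?W12_form_ge // L2inner_ge0.
Qed.

End W12Space.

(** * The spectrum of the Laplacian seen from its resolvent *)

Section Resolvent.
Context {R : realType} {X : completeMetricType R}.
Variable m : {measure set (borel X) -> \bar R}.
Variable ip : (borel X -> R) -> (borel X -> R) -> R.
Hypothesis ipP : W12_inner_product m ip.
Hypothesis Wc : W12_complete m.
Local Notation V := (W12_space m).
Local Notation form := (@W12_form R X m ip).
Local Notation inner := (@W12_L2inner R X m).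
Let formP : symmetric_bilinear form := W12_form_symmetric ipP.
Let form_ge0 : forall f : V, 0 <= form f f := W12_form_ge0 ipP.
Let innerP : symmetric_bilinear inner := W12_L2inner_symmetric m.
Let inner_ge0 : forall f : V, 0 <= inner f f.
Proof. by move=> f; exact: L2inner_ge0. Qed.

Variable T : V -> V.
Hypothesis TP : forall f h, form (T f) h = inner f h.

(** [T] plays the role of the resolvent [(1 - Delta)^-1], restricted to W^{1,2}:
    there it is symmetric, and its quadratic form is the squared norm of L^2. *)
Lemma resolvent_symmetric : symmetric_map (ip := form) T.
Proof. by move=> f g; rewrite TP (bilC innerP) (bilC formP) TP. Qed.

(** If [g = T f - f / (1 + lambda)] then [u = T f] solves
    [(- Delta - lambda) u = - (1 + lambda) g], so the resolvent bounds [u] by [g]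
    in L^2, then in W^{1,2}; and [f] is a combination of [u] and [g]. *)
Lemma resolvent_set_bounded_below (lambda : R) : -1 < lambda ->
  resolvent_set m (neg_laplacian m) lambda ->
  bounded_below (ip := form) (fun f => T f - (1 + lambda)^-1 *: f).
Proof.
move=> lam [_ _ [C HC]]; pose l := 1 + lambda.
have l0 : 0 < l by rewrite /l; lra.
pose c1 := (C * l) ^+ 2; have c10 : 0 <= c1 by exact: sqr_ge0.
pose c2 := 2 * l ^+ 2 * (c1 + 1) + c1.
have l2 : 0 < l ^+ 2 by rewrite exprn_gt0.
have c20 : 0 < c2 by rewrite /c2 ltr_wpDr // mulr_gt0 ?mulr_gt0 //; lra.
have c30 : 0 < l ^+ 2 * (2 * c2 + 2) by rewrite mulr_gt0 //; lra.
exists (l ^+ 2 * (2 * c2 + 2))^-1; first by rewrite invr_gt0.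
move=> f; rewrite ler_pdivrMl // -/l.
have [g gE] : exists g, g = T f - l^-1 *: f by exists (T f - l^-1 *: f).
have [u uE] : exists u, u = T f by exists (T f).
rewrite -gE; have fE : f = l *: (u - g).
  by rewrite gE uE opprB addrCA subrr addr0 scalerA divff ?scale1r // gt_eqF.
have u2 : inner u u <= c1 * inner g g.
  have wk := weak_neg_laplacian ipP (W12_L2 f) (TP f).
  have sh : shifted (neg_laplacian m) lambda (W12_val u) (W12_val (- l *: g)).
    rewrite /shifted uE; move: wk; congr neg_laplacian; apply/funext => x.
    have -> : W12_val (- l *: g) x =
        - l * (W12_val (T f) x - l^-1 * W12_val f x) by rewrite gE.
    move: (W12_val (T f) x) (W12_val f x) => a b.
    have -> : - l * (a - l^-1 * b) = b - l * a by field; rewrite gt_eqF.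
    by rewrite /l; ring.
  have := HC _ _ (W12_L2 _) sh.
  rewrite !L2norm_fin; try exact: W12_L2.
  rewrite -EFinM lee_fin -/(inner u u) -/(inner (- l *: g) (- l *: g)) => H.
  have : Num.sqrt (inner u u) ^+ 2 <= (C * Num.sqrt (inner (- l *: g) (- l *: g))) ^+ 2.
    by rewrite ler_sqr ?nnegrE ?sqrtr_ge0 // (le_trans _ H) ?sqrtr_ge0.
  rewrite exprMn !sqr_sqrtr // (bilZl innerP) (bilZr innerP) /c1 exprMn => H'.
  by apply: le_trans H' _; rewrite le_eqVlt; apply/orP; left; apply/eqP; ring.
have f2 : inner f f <= l ^+ 2 * (2 * inner u u + 2 * inner g g).
  rewrite fE (bilZl innerP) (bilZr innerP) mulrA -expr2 ler_pM2l //.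
  exact: ip_sub_le innerP inner_ge0 _ _.
have uu : form u u <= c2 * form g g.
  rewrite {1}uE TP; apply: (@le_trans _ _ (c2 * inner g g)); last first.
    by rewrite ler_pM2l // W12_form_ge.
  have : 2 * inner f u <= inner f f + inner u u.
    by have := inner_ge0 (f - u); rewrite !(bilE innerP) (bilC innerP u f); lra.
  have := ler_wpM2l (ltW l2) u2; have := inner_ge0 u; have := inner_ge0 f.
  rewrite /c2; lra.
have -> : form f f = l ^+ 2 * form (u - g) (u - g).
  by rewrite fE (bilZl formP) (bilZr formP) mulrA -expr2.
rewrite -(mulrA (l ^+ 2)) ler_pM2l //.
apply: le_trans (ip_sub_le formP form_ge0 _ _) _; lra.
Qed.

Lemma eigenvector_neg_laplacian (tau : R) (f : V) : 0 < tau ->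
  in_kernel (ip := form) (fun f => T f - tau *: f) f ->
  neg_laplacian m (W12_val f) (fun x => (tau^-1 - 1) * W12_val f x).
Proof.
move=> tau0 fk.
have wL : L2 m (fun x => tau^-1 * W12_val f x + cst 0 x).
  by apply: L2_scaleD; [exact: W12_L2|exact: L2_cst0].
have H h : form f h = L2inner m (fun x => tau^-1 * W12_val f x + cst 0 x) (W12_val h).
  rewrite (L2inner_scaleD tau^-1 (W12_L2 f) (L2_cst0 m) (W12_L2 h)) -/(inner f h) -TP.
  have := ip_null formP form_ge0 h fk; rewrite (bilBl formP) (bilZl formP) => /eqP.
  rewrite subr_eq0 => /eqP ->; rewrite mulrA mulVf ?gt_eqF // mul1r.
  suff -> : L2inner m (cst 0) (W12_val h) = 0 by rewrite addr0.
  rewrite /L2inner /Rintegral (eq_integral (cst 0%E)) ?integral0 // => x _ /=.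
  by rewrite mul0r.
have := weak_neg_laplacian ipP wL H.
congr neg_laplacian; apply/funext => x /=; rewrite /cst /=; ring.
Qed.

Lemma kernel_infinite_multiplicity (tau : R) : 0 < tau ->
  ~ finite_dimensional_kernel (ip := form) (fun f => T f - tau *: f) ->
  infinite_multiplicity m (neg_laplacian m) (tau^-1 - 1).
Proof.
move=> tau0 ninf n.
have [F [Fker Find]] : exists F : 'I_n -> V,
    (forall i, in_kernel (ip := form) (fun f => T f - tau *: f) (F i)) /\
    independent (ip := form) F.
  by apply: contrapT => H; apply: ninf; exists n.
exists (fun i => W12_val (F i)); split => [i|c c0].
  exact: eigenvector_neg_laplacian tau0 (Fker i).
apply: Find; move vE : (\sum_i _) => v.
have vs w : form v w = \sum_i c i * form (F i) w by rewrite -vE (bil_suml formP).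
have Tv : form (T v) v = tau * form v v.
  rewrite resolvent_symmetric !vs mulr_sumr; apply: eq_bigr => i _.
  rewrite -resolvent_symmetric mulrCA; congr (_ * _).
  have := ip_null formP form_ge0 v (Fker i); rewrite (bilBl formP) (bilZl formP).
  by move=> /eqP; rewrite subr_eq0 => /eqP.
have v0 : inner v v = 0.
  rewrite /W12_L2inner /L2inner /Rintegral (ae_eq_integral (cst 0%E)) ?integral0 //.
    apply/measurable_EFinP; apply: measurable_funM; apply: L2_measurable; exact: W12_L2.
  move: c0; apply: filterS => x H _; rewrite -vE W12_val_sum H //=.
  by rewrite /cst mul0r.
by move: Tv; rewrite TP v0 => /esym/eqP; rewrite mulf_eq0 gt_eqF //= => /eqP.
Qed.

Lemma spectrum_limit_point (tau : R) : 0 < tau ->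
  (forall r, 0 < r -> exists2 c, 0 < `|c| < r &
     ~ bounded_below (ip := form) (fun f => T f - (tau + c) *: f)) ->
  limit_point (spectrum m (neg_laplacian m)) (tau^-1 - 1).
Proof.
move=> tau0 H U; rewrite -nbhs_ballE => -[r /= r0 rU].
have t2 : 0 < tau ^+ 2 by rewrite exprn_gt0.
have h0 : 0 < Num.min (tau / 2) (r * tau ^+ 2 / 2).
  by rewrite lt_min !divr_gt0 // mulr_gt0.
have [c /andP[c0]] := H _ h0; rewrite lt_min => /andP[c1 c2] nb.
have tc : tau / 2 < tau + c.
  by have := ler_norm (- c); rewrite normrN; lra.
have tc0 : 0 < tau + c by lra.
exists ((tau + c)^-1 - 1); split.
- apply/eqP => /addIr/invr_inj tE; have c00 : c = 0 by lra.
  by rewrite c00 normr0 ltxx in c0.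
- move=> res; apply: nb.
  have lam : -1 < (tau + c)^-1 - 1 by rewrite ltrBrDl subrr invr_gt0.
  have := resolvent_set_bounded_below lam res.
  by rewrite addrC subrK invrK.
- apply: rU; rewrite /ball /=.
  have -> : tau^-1 - 1 - ((tau + c)^-1 - 1) = c / (tau * (tau + c)).
    by field; rewrite !gt_eqF.
  rewrite normrM normfV (gtr0_norm (mulr_gt0 tau0 tc0)) ltr_pdivrMr ?mulr_gt0 //.
  apply: lt_trans c2 _; rewrite -mulrA ltr_pM2l // expr2 -mulrA ltr_pM2l //.
Qed.

(** The spectral parameter [lambda] of the Laplacian corresponds to
    [tau = 1 / (1 + lambda)] for [T], and the Rayleigh quotient of [T] at [f] is
    the ratio of the squared norms of [f] in L^2 and in W^{1,2}. *)
Theorem essential_spectrum_of_energy (lam0 : R) : 0 <= lam0 ->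
  (forall (gs : seq V) (e : R), 0 < e -> exists f : V,
     [/\ 0 < inner f f, forall g, g \in gs -> form f g = 0 &
         form f f <= (1 + lam0 + e) * inner f f]) ->
  essential_spectrum m (neg_laplacian m) `&` `[0, lam0] !=set0.
Proof.
move=> lam00 H; have l0 : 0 < 1 + lam0 by lra.
have [||gs e e0||tau [tau_ge tau_le dich]] := @essential_spectrum_of_Rayleigh R V form
  formP form_ge0 T (1 + lam0)^-1 (W12_snorm_complete ipP Wc) resolvent_symmetric.
- by move=> f; rewrite TP.
- by move=> f; rewrite TP W12_form_ge.
- have [f [f0 fgs fe]] := H gs e e0; exists f; split=> //.
    by apply: lt_le_trans f0 _; exact: W12_form_ge.
  rewrite TP; have [le0|gt0] := leP ((1 + lam0)^-1 - e) 0.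
    by apply: le_trans (mulr_le0_ge0 le0 (form_ge0 f)) _.
  apply: le_trans (ler_wpM2l (ltW gt0) fe) _; rewrite mulrA ler_piMl //.
  have i1 : (1 + lam0)^-1 <= 1 by rewrite invf_le1 //; lra.
  have -> : ((1 + lam0)^-1 - e) * (1 + lam0 + e) =
      1 - e * (1 + lam0 - (1 + lam0)^-1) - e ^+ 2.
    by field; rewrite gt_eqF.
  have : 0 <= e * (1 + lam0 - (1 + lam0)^-1) by rewrite mulr_ge0 ?(ltW e0) //; lra.
  by have := sqr_ge0 e; lra.
- by rewrite invr_ge0 ltW.
have tau0 : 0 < tau by apply: lt_le_trans tau_ge; rewrite invr_gt0.
exists (tau^-1 - 1); split; last first.
  rewrite /= in_itv /= subr_ge0 invf_ge1 // tau_le /= lerBlDl.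
  by rewrite -[leRHS]invrK lef_pV2 ?posrE ?invr_gt0.
case: dich => [lim|inf]; [left|right].
  exact: spectrum_limit_point.
exact: kernel_infinite_multiplicity.
Qed.

End Resolvent.

(** * Trial functions with disjoint supports *)

Lemma sqr_sum_orthogonal (R : comNzRingType) n (a : 'I_n -> R) :
  (forall i j, i != j -> a i * a j = 0) -> (\sum_i a i) ^+ 2 = \sum_i a i ^+ 2.
Proof.
move=> a0; rewrite expr2 mulr_suml; apply: eq_bigr => i _.
rewrite (bigD1 i) //= mulrDr mulr_sumr big1 ?addr0 ?expr2 // => j ji.
by rewrite a0 // eq_sym.
Qed.

Lemma kernel_vector (F : fieldType) k n (A : 'M[F]_(n, k)) : (k < n)%N ->
  exists2 c : 'I_n -> F, (exists i, c i != 0) &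
    forall j, \sum_i c i * A i j = 0.
Proof.
move=> kn; have : kermx A != 0.
  rewrite -mxrank_eq0 mxrank_ker subn_eq0 -ltnNge.
  exact: leq_ltn_trans (rank_leq_col A) kn.
move=> /eqP kA; have [i [j ij]] : exists i j, kermx A i j != 0.
  apply: contrapT => H; apply: kA; apply/matrixP => i j; rewrite [RHS]mxE.
  by apply/eqP/negPn/negP => ij; apply: H; exists i, j.
exists (fun j => kermx A i j); first by exists j.
move=> l; have := mulmx_ker A; move=> /matrixP/(_ i l).
by rewrite mxE [RHS]mxE.
Qed.

Section ConeCombinations.
Context {R : realType} {X : completeMetricType R}.
Variable m : {measure set (borel X) -> \bar R}.
Hypothesis Xm : metric_measure_space m.
Implicit Types (b D : R) (x : X).

Lemma cone_lipschitz_bs b D x : 0 <= b -> lipschitz_bs (cone b D x : borel X -> R).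
Proof.
move=> b0; split; first by exists b; exact: cone_Lipschitz.
exists x, (D + 1) => y; rewrite ballEmdist /= => yc.
have [z [zc yz]] := yc _ (nbhsx_ballx y _ ltr01).
have xz : mdist x z < D.
  by rewrite ltNge; apply/negP => Dz; move: zc; rewrite /= cone_eq0 ?eqxx.
move: yz; rewrite ballEmdist /= => yz.
by have := metric_triangle x z y; rewrite (metric_sym z); lra.
Qed.

Lemma cone_slope_bound b D x y : 0 < b ->
  fine (slope (cone b D x : borel X -> R) y) <= cone_slope b D x y.
Proof.
move=> b0; apply/ler_addgt0Pr => e e0.
have [r r0 Hr] := @cone_local_Lipschitz _ _ b D x y e b0 e0.
rewrite -lee_fin fineK; last exact: Lipschitz_slope_fin (cone_Lipschitz _ _ (ltW b0)).
by apply: (slope_le_fin r0) => //; rewrite addr_ge0 ?(ltW e0) // cone_slope_ge0 // ltW.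
Qed.

Lemma lipschitz_bs_sum (I : Type) (s : seq I) (c : I -> R) (F : I -> borel X -> R) :
  (forall i, lipschitz_bs (F i)) ->
  lipschitz_bs (fun x => \sum_(i <- s) c i * F i x) /\
  forall x, fine (slope (fun x => \sum_(i <- s) c i * F i x) x) <=
    \sum_(i <- s) `|c i| * fine (slope (F i) x).
Proof.
move=> FL; elim: s => [|i s [IH1 IH2]].
  rewrite (_ : (fun x => _) = cst 0); last by apply/funext => x; rewrite big_nil.
  split=> [|x]; first exact: lipschitz_bs_cst0.
  rewrite big_nil (_ : slope _ x = 0%E) //.
  apply/eqP; rewrite eq_le slope_ge0 andbT; apply: (slope_le_fin ltr01) => // z _.
  by rewrite subrr normr0 mul0r.
rewrite (_ : (fun x => _) = fun x => c i * F i x + \sum_(j <- s) c j * F j x);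
  last by apply/funext => x; rewrite big_cons.
split=> [|x]; first exact: lipschitz_bs_scaleD.
rewrite big_cons; have [L FiL] := lipschitz_bs_Lipschitz (FL i).
have [M sM] := lipschitz_bs_Lipschitz IH1.
by apply: le_trans (slope_scaleD (c i) x FiL sM) _; rewrite lerD2l.
Qed.

Variables (b D : R) (y : nat -> X).
Hypotheses (b0 : 0 < b) (D1 : 1 < D).
Hypothesis y_far : forall i j, (i < j)%N -> 2 * D + 1 <= mdist (y i) (y j).

Lemma y_far_neq i j : i != j -> 2 * D + 1 <= mdist (y i) (y j).
Proof.
by rewrite neq_ltn => /orP[/y_far//|/y_far]; rewrite metric_sym.
Qed.

Lemma cone_disjoint i j x : i != j -> cone b D (y i) x * cone b D (y j) x = 0.
Proof.
move=> /y_far_neq ij; have [xi|xi] := leP D (mdist (y i) x).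
  by rewrite cone_eq0 ?mul0r // ltW.
have xj : D <= mdist (y j) x.
  by have := metric_triangle (y i) x (y j); rewrite (metric_sym x); lra.
by rewrite [X in _ * X]cone_eq0 ?mulr0 // ltW.
Qed.

Lemma cone_slope_disjoint i j x : i != j ->
  cone_slope b D (y i) x * cone_slope b D (y j) x = 0.
Proof.
move=> /y_far_neq ij; rewrite /cone_slope.
case: ifP => xi; last by rewrite mul0r.
case: ifP => xj; last by rewrite mulr0.
by have := metric_triangle (y i) x (y j); rewrite (metric_sym x); lra.
Qed.

Lemma integral_sqr_combination n (c : 'I_n -> R) (F : 'I_n -> borel X -> R) :
  (forall i, measurable_fun setT (F i)) ->
  (forall i j x, i != j -> F i x * F j x = 0) ->
  sqint m (fun x => \sum_i c i * F i x) = (\sum_i (c i ^+ 2)%:E * sqint m (F i))%E.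
Proof.
move=> mF F0; rewrite /sqint.
transitivity (\int[m]_x (\sum_(i < n) ((c i * F i x) ^+ 2)%:E))%E.
  apply: eq_integral => x _; rewrite sumEFin; congr (_%:E).
  by apply: sqr_sum_orthogonal => i j ij; rewrite mulrACA F0 // mulr0.
rewrite ge0_integral_sum //.
- apply: eq_bigr => i _.
  have p (x : borel X) : setT x -> (0 <= (F i x ^+ 2)%:E)%E by rewrite lee_fin sqr_ge0.
  rewrite -(ge0_integralZl_EFin _ measurableT p (measurable_sq (mF i)) (sqr_ge0 _)).
  by apply: eq_integral => x _; rewrite exprMn EFinM.
- by move=> i; apply: measurable_sq; exact: measurable_funM.
- by move=> i x _; rewrite lee_fin sqr_ge0.
Qed.

Lemma cone_L2 x : L2 m (cone b D x).
Proof.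
by apply/L2P; split; [exact: measurable_cone (ltW b0)|exact: cone_energy_fin (ltW b0)].
Qed.

Lemma cone_energy_gt0 x : 0 < L2inner m (cone b D x) (cone b D x).
Proof.
rewrite -lte_fin -sqintE; last exact: cone_L2.
apply: lt_le_trans (cone_energy_ge Xm x b0 (ltW D1)).
rewrite lte_fin mulr_gt0 ?mball_pos // exprn_gt0 // subr_gt0 ltr_expR ltrN2.
by rewrite ltr_pMr.
Qed.

(** The cones have disjoint supports, so that both sides are diagonal in the
    coefficients. *)
Lemma cone_combination_energy (E : R) n (c : 'I_n -> R) : 0 <= E ->
  (forall x, (\int[m]_z (cone_slope b D x z ^+ 2)%:E <=
     E%:E * \int[m]_z (cone b D x z ^+ 2)%:E)%E) ->
  let f x := \sum_i c i * cone b D (y i) x in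
  [/\ lipschitz_bs (f : borel X -> R), L2 m f &
      (slope_energy m f <= E%:E * sqint m f)%E].
Proof.
move=> E0 HE f.
have cl i : lipschitz_bs (cone b D (y i) : borel X -> R) by exact: cone_lipschitz_bs (ltW b0).
have [fl fs] := @lipschitz_bs_sum 'I_n (index_enum 'I_n) c
  (fun i => cone b D (y i)) (fun i => cl i).
have dis (i j : 'I_n) x : i != j -> cone b D (y i) x * cone b D (y j) x = 0.
  by move=> ij; exact: cone_disjoint.
have sqf := integral_sqr_combination c (fun i : 'I_n => measurable_cone D (y i) (ltW b0)) dis.
have [L fL] := lipschitz_bs_Lipschitz fl.
split=> //.
  apply/L2P; split; first exact: Lipschitz_measurable fL.
  rewrite sqf; apply: lte_sum_pinfty => i _.
  by rewrite lte_mul_pinfty ?lee_fin ?sqr_ge0 //; exact: cone_energy_fin (ltW b0).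
apply: (@le_trans _ _ (sqint m (fun x => \sum_i `|c i| * cone_slope b D (y i) x))).
  apply: ge0_le_integral => //.
  - by move=> x _; rewrite expe_ge0 // slope_ge0.
  - rewrite (_ : (fun x => _) = (fun x => slope f x * slope f x)%E); last first.
      by apply/funext => x; rewrite expe2.
    by apply: emeasurable_funM; exact: measurable_slope fL.
  - apply: measurable_sq; apply: measurable_sum => i; apply: measurable_funM => //.
    exact: measurable_cone_slope.
  move=> x _; rewrite -(fineK (Lipschitz_slope_fin x fL)) -EFin_expe lee_fin.
  have H : fine (slope f x) <= \sum_i `|c i| * cone_slope b D (y i) x.
    apply: le_trans (fs x) _; apply: ler_sum => i _.
    by rewrite ler_wpM2l // cone_slope_bound.
  have s0 : 0 <= fine (slope f x) by rewrite fine_ge0 // slope_ge0.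
  by rewrite ler_sqr ?nnegrE // (le_trans s0).
rewrite integral_sqr_combination; last 2 first.
- by move=> i; exact: measurable_cone_slope.
- by move=> i j x ij; exact: cone_slope_disjoint.
rewrite sqf ge0_sume_distrr; last first.
  by move=> i _; rewrite mule_ge0 ?lee_fin ?sqr_ge0 // sqint_ge0.
apply: lee_sum => i _; rewrite real_normK ?num_real // muleCA.
by apply: lee_wpmul2l; [rewrite lee_fin sqr_ge0|exact: HE].
Qed.

(** Among the combinations of more cones than there are constraints, a nonzero one
    satisfies the constraints. *)
Lemma cone_trial_function (ip : (borel X -> R) -> (borel X -> R) -> R) (E : R)
    (gs : seq (W12_space m)) : W12_inner_product m ip -> 0 <= E ->
  (forall x, (\int[m]_z (cone_slope b D x z ^+ 2)%:E <=
     E%:E * \int[m]_z (cone b D x z ^+ 2)%:E)%E) ->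
  exists f : W12_space m,
    [/\ 0 < W12_L2inner f f, forall g, g \in gs -> W12_form ip f g = 0 &
        W12_form ip f f <= (1 + E) * W12_L2inner f f].
Proof.
move=> ipP E0 HE; pose n := (size gs).+1.
have formP := W12_form_symmetric ipP.
have cW (i : 'I_n) : W12 m (cone b D (y i)).
  have [fl fL fE] := @cone_combination_energy E n (fun j => (j == i)%:R) E0 HE.
  rewrite (_ : cone _ _ _ = fun x => \sum_j (j == i)%:R * cone b D (y j) x).
    apply: lipschitz_bs_W12 => //; apply: le_lt_trans fE _.
    by rewrite lte_mul_pinfty // sqint_lty.
  apply/funext => x; rewrite (bigD1 i) //= eqxx mul1r big1 ?addr0 // => j /negPf ->.
  by rewrite mul0r.
pose C (i : 'I_n) := MkW12 (mem_set (cW i) : _ \in W12_mem m).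
have [c [i0 ci0] c0] := @kernel_vector R (size gs) n
  (\matrix_(i, j) W12_form ip (C i) (nth 0 gs j)) (leqnn _).
have [fl fL fE] := @cone_combination_energy E n c E0 HE.
pose f := \sum_i c i *: C i.
have fV : W12_val f = (fun x => \sum_i c i * cone b D (y i) x) by exact: W12_val_sum.
have fn : W12_L2inner f f = \sum_i c i ^+ 2 * L2inner m (cone b D (y i)) (cone b D (y i)).
  apply: EFin_inj; rewrite /W12_L2inner fV -sqintE // integral_sqr_combination.
  - rewrite -sumEFin; apply: eq_bigr => i _; rewrite EFinM sqintE //; exact: cone_L2.
  - by move=> i; exact: measurable_cone (ltW b0).
  - by move=> i j x ij; exact: cone_disjoint.
exists f; split.
- rewrite fn (bigD1 i0) //= ltr_pwDl //.
    by rewrite mulr_gt0 ?cone_energy_gt0 // exprn_even_gt0 //= ci0 orbT.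
  by apply: sumr_ge0 => i _; rewrite mulr_ge0 ?sqr_ge0 // L2inner_ge0.
- move=> g /(nthP 0)[j js <-]; rewrite (bil_suml formP).
  by have := c0 (Ordinal js); under eq_bigr => i _ do rewrite mxE.
- rewrite -lee_fin (W12_formE ipP) mulrDl mul1r [leRHS]EFinD; apply: leeD => //.
  have := Ch_le_slope m fl; rewrite -fV => H.
  apply: le_trans (lee_wpmul2l _ H) _ => //.
  rewrite muleA -EFinM divff // mul1e fV; apply: le_trans fE _.
  by rewrite EFinM sqintE // /W12_L2inner fV.
Qed.

End ConeCombinations.

(** * The essential spectrum of a non-compact RCD space *)

Unset Implicit Arguments.
Set Strict Implicit.
Set Printing Implicit Defensive.

Theorem theorem3p7 (R : realType) (X : completeMetricType R)
    (m : {measure set (borel X) -> \bar R}) (K N : R)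
    (hK : K <= 0) (hN : 3 <= N) (hX : ~ compact [set: X])
    (hm : RCD m K N) :
  essential_spectrum m (neg_laplacian m) `&` `[0, - ((N - 1) * K / 4)]
    !=set0.
Proof.
have [Xm cd [[ip ipP] Wc]] := hm.
have N1 : 1 < N by lra.
have lam0 : 0 <= - ((N - 1) * K / 4).
  rewrite oppr_ge0 pmulr_lle0 ?invr_gt0 // pmulr_rle0 //; lra.
have [T TP] := choice (W12_resolvent_exists ipP Wc).
apply: (essential_spectrum_of_energy ipP Wc TP lam0) => gs e e0.
have [b [D [b0 D1 HE]]] := cone_Rayleigh Xm cd hK N1 e0.
have [y yfar] := @far_sequence R X (2 * D + 1) (CD_noncompact_unbounded Xm cd hK N1 hX).
have E0 : 0 <= - ((N - 1) * K / 4) + e by rewrite addr_ge0 // ltW.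
have [f [f0 fgs fE]] := cone_trial_function Xm b0 D1 yfar gs ipP E0 HE.
by exists f; split=> //; rewrite -addrA.
Qed.
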